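(* For each of the calculi $\mathcal{E}$, $\mathcal{E}^{r}$, $\mathcal{F}_{2015}$, $\mathcal{M}'_{2015}$ and $\mathcal{M}_{2015}$, the derivability problem restricted to its one-division fragment is algorithmically undecidable; here the one-division fragment consists of the sequents all of whose formulae are built from variables using only $/$, $!$ and (for the bracketed calculi) $\langle\rangle$ and $[]^{-1}$, possibly with brackets in the antecedent.
   Context: Formulae are built from a countable set of variables and $\mathbf1$ by $\backslash,/,\cdot,\wedge,\vee$ and the unary $\langle\rangle$, $[]^{-1}$, $!$. Bracket-free calculi: sequents $\Pi\to A$ with $\Pi$ a finite (possibly empty, $\Lambda$) sequence of formulae without bracket modalities. $\mathcal{E}$ has axioms $A\to A$, $\Lambda\to\mathbf1$ and rules: ($\backslash L$) from $\Pi\to A$ and $\Delta_1,B,\Delta_2\to C$ infer $\Delta_1,\Pi,A\backslash B,\Delta_2\to C$; ($\backslash R$) from $A,\Pi\to B$ infer $\Pi\to A\backslash B$; ($/L$) from $\Pi\to A$ and $\Delta_1,B,\Delta_2\to C$ infer $\Delta_1,B/A,\Pi,\Delta_2\to C$; ($/R$) from $\Pi,A\to B$ infer $\Pi\to B/A$; ($\cdot L$), ($\cdot R$), ($\mathbf1L$), ($\wedge L_i$), ($\wedge R$), ($\vee L$), ($\vee R_i$) as standard; ($!R$) from $!A_1,\dots,!A_n\to B$ infer $!A_1,\dots,!A_n\to!B$ ($n\ge0$); ($!L$) from $\Delta_1,A,\Delta_2\to C$ infer $\Delta_1,!A,\Delta_2\to C$; ($!P_1$) from $\Delta_1,!A,\Phi,\Delta_2\to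 C$ infer $\Delta_1,\Phi,!A,\Delta_2\to C$; ($!P_2$) the converse; ($!C$) from $\Delta_1,!A,!A,\Delta_2\to C$ infer $\Delta_1,!A,\Delta_2\to C$; ($!W$) from $\Delta_1,\Delta_2\to C$ infer $\Delta_1,!A,\Delta_2\to C$; (cut) from $\Pi\to A$ and $\Delta_1,A,\Delta_2\to C$ infer $\Delta_1,\Pi,\Delta_2\to C$. $\mathcal{E}^r$ is $\mathcal{E}$ without $!W$. Bracketed calculi with stoups: a stoup is a finite multiset of formulae ($\varnothing$ empty); a tree term is a formula or $[\Xi]$; a meta-formula is $\zeta;\Gamma$ ($\zeta$ a stoup, $\Gamma$ a finite sequence of tree terms, empty $\Lambda$), $\varnothing;\Gamma$ written $\Gamma$; comma is concatenation / multiset union; sequents $\Xi\to C$; $\Xi(\Theta)$ designates an occurrence of a meta-formula $\Theta$ which is $\Xi$ itself or the content of a bracket $[\Theta]$ at any depth. Common rules: axioms $A\to A$, $\Lambda\to\mathbf1$; ($/L$) from $\zeta_1;\Gamma\to B$ and $\Xi(\zeta_2;\Delta_1,C,\Delta_2)\to D$ infer $\Xi(\zeta_1,\zeta_2;\Delta_1,C/B,\Gamma,\Delta_2)\to D$; ($/R$) from $\zeta;\Gamma,B\to C$ infer $\zeta;\Gamma\to C/B$; ($\backslash L$) from $\zeta_1;\Gamma\to A$ and $\Xi(\zeta_2;\Delta_1,C,\Delta_2)\to D$ infer $\Xi(\zeta_1,\zeta_2;\Delta_1,\Gamma,A\backslash C,\Delta_2)\to D$; ($\backslash R$) from $\zeta;A,\Gamma\to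 C$ infer $\zeta;\Gamma\to A\backslash C$; ($\cdot L$) from $\Xi(\zeta;\Delta_1,A,B,\Delta_2)\to D$ infer $\Xi(\zeta;\Delta_1,A\cdot B,\Delta_2)\to D$; ($\cdot R$) from $\zeta_1;\Delta\to A$, $\zeta_2;\Gamma\to B$ infer $\zeta_1,\zeta_2;\Delta,\Gamma\to A\cdot B$; ($\mathbf1L$) from $\Xi(\zeta;\Delta_1,\Delta_2)\to A$ infer $\Xi(\zeta;\Delta_1,\mathbf1,\Delta_2)\to A$; additive rules with context $\Xi(\zeta;\Delta_1,\cdot,\Delta_2)$ on the left and arbitrary $\Xi$ on the right; ($[]^{-1}L$) from $\Xi(\zeta;\Delta_1,A,\Delta_2)\to B$ infer $\Xi(\zeta;\Delta_1,[[]^{-1}A],\Delta_2)\to B$; ($[]^{-1}R$) from $[\Xi]\to A$ infer $\Xi\to[]^{-1}A$; ($\langle\rangle L$) from $\Xi(\zeta;\Delta_1,[A],\Delta_2)\to B$ infer $\Xi(\zeta;\Delta_1,\langle\rangle A,\Delta_2)\to B$; ($\langle\rangle R$) from $\Xi\to A$ infer $[\Xi]\to\langle\rangle A$; ($!L$) from $\Xi(\zeta,A;\Gamma_1,\Gamma_2)\to B$ infer $\Xi(\zeta;\Gamma_1,!A,\Gamma_2)\to B$; ($!P$) from $\Xi(\zeta;\Gamma_1,A,\Gamma_2)\to B$ infer $\Xi(\zeta,A;\Gamma_1,\Gamma_2)\to B$. $\mathcal{M}_{2015}$ adds ($!R$) from $\zeta;\Lambda\to B$ infer $\zeta;\Lambda\to!B$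 and ($!C$) from $\Xi(\zeta_1,\zeta_2;\Gamma_1,[\zeta_2;\Gamma_2],\Gamma_3)\to B$ infer $\Xi(\zeta_1,\zeta_2;\Gamma_1,\Gamma_2,\Gamma_3)\to B$ if $\zeta_2\ne\varnothing$. $\mathcal{M}'_{2015}$ adds ($!R'$) as $!R$ but only if $\zeta\ne\varnothing$, and ($!C'$) from $\Xi(\zeta_1,\zeta_2;\Gamma_1,[\zeta',\zeta_2;\Gamma_2],\Gamma_3)\to C$ infer $\Xi(\zeta_1,\zeta_2,\zeta';\Gamma_1,\Gamma_2,\Gamma_3)\to C$ if $\zeta_2\neq\varnothing$. Cut is not a rule of these. Stoup-free $\mathcal{F}_{2015}$: meta-formulae are finite sequences of tree terms; rules are the stoup-free versions of the common rules (drop all stoups), except $!L$ is: from $\Xi(\Delta_1,A,\Delta_2)\to C$ infer $\Xi(\Delta_1,!A,\Delta_2)\to C$; plus ($!P_1$) from $\Xi(\Delta_1,!A,\Phi,\Delta_2)\to C$ infer $\Xi(\Delta_1,\Phi,!A,\Delta_2)\to C$, ($!P_2$) the converse, ($!R$) from $!A_1,\dots,!A_n\to B$ infer $!A_1,\dots,!A_n\to!B$ ($n\ge1$), ($!C$) from $\Xi(!A_1,\dots,!A_n,\Gamma_1,[!A_1,\dots,!A_n,\Gamma_2],\Gamma_3)\to C$ infer $\Xi(!A_1,\dots,!A_n,\Gamma_1,\Gamma_2,\Gamma_3)\to C$ ($n\ge1$), and (cut) from $\Pi\to A$ and $\Xi(\Gamma_1,A,\Gamma_2)\to C$ infer $\Xi(\Gamma_1,\Pi,\Gamma_2)\to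 C$. *)

(* Defs.v *)
From Stdlib Require Import Permutation.
From mathcomp Require Import all_boot.

Set Implicit Arguments.
Unset Strict Implicit.
Unset Printing Implicit Defensive.

(* Ld a b  is  a \ b ;  Rd b a  is  b / a ;  Dia a is <>a ;
   Box a is []^{-1} a ;  Bang a is !a. *)
Inductive fm : Type :=
| V (n : nat)
| One
| Ld (a b : fm)
| Rd (b a : fm)
| Mul (a b : fm)
| And (a b : fm)
| Or (a b : fm)
| Dia (a : fm)
| Box (a : fm)
| Bang (a : fm).

Fixpoint nobr (A : fm) : Prop :=
  match A with
  | V _ | One => True
  | Ld a b | Rd a b | Mul a b | And a b | Or a b => nobr a /\ nobr b
  | Dia _ | Box _ => False
  | Bang a => nobr a
  end.

Definition is_bang (A : fm) : Prop := exists B, A = Bang B.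

Inductive Eder (w : bool) : seq fm -> fm -> Prop :=
| E_ax A : nobr A -> Eder w [:: A] A
| E_one : Eder w [::] One
| E_LdL Pi A B D1 D2 C :
    Eder w Pi A -> Eder w (D1 ++ B :: D2) C ->
    Eder w (D1 ++ Pi ++ Ld A B :: D2) C
| E_LdR A Pi B : Eder w (A :: Pi) B -> Eder w Pi (Ld A B)
| E_RdL Pi A B D1 D2 C :
    Eder w Pi A -> Eder w (D1 ++ B :: D2) C ->
    Eder w (D1 ++ Rd B A :: Pi ++ D2) C
| E_RdR Pi A B : Eder w (Pi ++ [:: A]) B -> Eder w Pi (Rd B A)
| E_MulL D1 A B D2 C : Eder w (D1 ++ A :: B :: D2) C ->
    Eder w (D1 ++ Mul A B :: D2) C
| E_MulR Pi D A B : Eder w Pi A -> Eder w D B -> Eder w (Pi ++ D) (Mul A B)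
| E_OneL D1 D2 C : Eder w (D1 ++ D2) C -> Eder w (D1 ++ One :: D2) C
| E_AndL1 D1 A B D2 C : nobr B -> Eder w (D1 ++ A :: D2) C ->
    Eder w (D1 ++ And A B :: D2) C
| E_AndL2 D1 A B D2 C : nobr A -> Eder w (D1 ++ B :: D2) C ->
    Eder w (D1 ++ And A B :: D2) C
| E_AndR Pi A B : Eder w Pi A -> Eder w Pi B -> Eder w Pi (And A B)
| E_OrL D1 A B D2 C : Eder w (D1 ++ A :: D2) C -> Eder w (D1 ++ B :: D2) C ->
    Eder w (D1 ++ Or A B :: D2) C
| E_OrR1 Pi A B : nobr B -> Eder w Pi A -> Eder w Pi (Or A B)
| E_OrR2 Pi A B : nobr A -> Eder w Pi B -> Eder w Pi (Or A B)
| E_BangR Pi B : (forall X, List.In X Pi -> is_bang X) -> Eder w Pi B ->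
    Eder w Pi (Bang B)
| E_BangL D1 A D2 C : Eder w (D1 ++ A :: D2) C -> Eder w (D1 ++ Bang A :: D2) C
| E_BangP1 D1 A Phi D2 C : Eder w (D1 ++ Bang A :: Phi ++ D2) C ->
    Eder w (D1 ++ Phi ++ Bang A :: D2) C
| E_BangP2 D1 A Phi D2 C : Eder w (D1 ++ Phi ++ Bang A :: D2) C ->
    Eder w (D1 ++ Bang A :: Phi ++ D2) C
| E_BangC D1 A D2 C : Eder w (D1 ++ Bang A :: Bang A :: D2) C ->
    Eder w (D1 ++ Bang A :: D2) C
| E_BangW D1 A D2 C : w -> nobr A -> Eder w (D1 ++ D2) C ->
    Eder w (D1 ++ Bang A :: D2) C
| E_cut Pi A D1 D2 C : nobr A -> Eder w Pi A -> Eder w (D1 ++ A :: D2) C ->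
    Eder w (D1 ++ Pi ++ D2) C.

Definition E_derivable (G : seq fm) (C : fm) : Prop := Eder true G C.
Definition Er_derivable (G : seq fm) (C : fm) : Prop := Eder false G C.

(* A stoup is represented by a list, taken up to permutation (rule M_perm).
   A meta-formula  zeta;Gamma  is the pair (zeta, Gamma). *)
Inductive tm : Type :=
| TF (A : fm)
| TB (z : seq fm) (g : seq tm).

Definition meta := (seq fm * seq tm)%type.

Inductive mctx : Type :=
| MHole
| MBr (z : seq fm) (l : seq tm) (c : mctx) (r : seq tm).

Fixpoint mplug (X : mctx) (m : meta) : meta :=
  match X with
  | MHole => m
  | MBr z l c r => let m' := mplug c m in (z, l ++ TB m'.1 m'.2 :: r)
  end.

Inductive Mder (primed : bool) : meta -> fm -> Prop :=
| M_perm X z z' G C : Permutation z z' ->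
    Mder primed (mplug X (z, G)) C -> Mder primed (mplug X (z', G)) C
| M_ax A : Mder primed ([::], [:: TF A]) A
| M_one : Mder primed ([::], [::]) One
| M_RdL z1 Ga B X z2 D1 C D2 D :
    Mder primed (z1, Ga) B -> Mder primed (mplug X (z2, D1 ++ TF C :: D2)) D ->
    Mder primed (mplug X (z1 ++ z2, D1 ++ TF (Rd C B) :: Ga ++ D2)) D
| M_RdR z Ga B C : Mder primed (z, Ga ++ [:: TF B]) C ->
    Mder primed (z, Ga) (Rd C B)
| M_LdL z1 Ga A X z2 D1 C D2 D :
    Mder primed (z1, Ga) A -> Mder primed (mplug X (z2, D1 ++ TF C :: D2)) D ->
    Mder primed (mplug X (z1 ++ z2, D1 ++ Ga ++ TF (Ld A C) :: D2)) D
| M_LdR z A Ga C : Mder primed (z, TF A :: Ga) C ->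
    Mder primed (z, Ga) (Ld A C)
| M_MulL X z D1 A B D2 D :
    Mder primed (mplug X (z, D1 ++ TF A :: TF B :: D2)) D ->
    Mder primed (mplug X (z, D1 ++ TF (Mul A B) :: D2)) D
| M_MulR z1 De A z2 Ga B :
    Mder primed (z1, De) A -> Mder primed (z2, Ga) B ->
    Mder primed (z1 ++ z2, De ++ Ga) (Mul A B)
| M_OneL X z D1 D2 A :
    Mder primed (mplug X (z, D1 ++ D2)) A ->
    Mder primed (mplug X (z, D1 ++ TF One :: D2)) A
| M_AndL1 X z D1 A B D2 C :
    Mder primed (mplug X (z, D1 ++ TF A :: D2)) C ->
    Mder primed (mplug X (z, D1 ++ TF (And A B) :: D2)) C
| M_AndL2 X z D1 A B D2 C :
    Mder primed (mplug X (z, D1 ++ TF B :: D2)) C ->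
    Mder primed (mplug X (z, D1 ++ TF (And A B) :: D2)) C
| M_AndR Xi A B : Mder primed Xi A -> Mder primed Xi B ->
    Mder primed Xi (And A B)
| M_OrL X z D1 A B D2 C :
    Mder primed (mplug X (z, D1 ++ TF A :: D2)) C ->
    Mder primed (mplug X (z, D1 ++ TF B :: D2)) C ->
    Mder primed (mplug X (z, D1 ++ TF (Or A B) :: D2)) C
| M_OrR1 Xi A B : Mder primed Xi A -> Mder primed Xi (Or A B)
| M_OrR2 Xi A B : Mder primed Xi B -> Mder primed Xi (Or A B)
| M_BoxL X z D1 A D2 B :
    Mder primed (mplug X (z, D1 ++ TF A :: D2)) B ->
    Mder primed (mplug X (z, D1 ++ TB [::] [:: TF (Box A)] :: D2)) B
| M_BoxR z Ga A : Mder primed ([::], [:: TB z Ga]) A ->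
    Mder primed (z, Ga) (Box A)
| M_DiaL X z D1 A D2 B :
    Mder primed (mplug X (z, D1 ++ TB [::] [:: TF A] :: D2)) B ->
    Mder primed (mplug X (z, D1 ++ TF (Dia A) :: D2)) B
| M_DiaR z Ga A : Mder primed (z, Ga) A ->
    Mder primed ([::], [:: TB z Ga]) (Dia A)
| M_BangL X z A G1 G2 B :
    Mder primed (mplug X (z ++ [:: A], G1 ++ G2)) B ->
    Mder primed (mplug X (z, G1 ++ TF (Bang A) :: G2)) B
| M_BangP X z G1 A G2 B :
    Mder primed (mplug X (z, G1 ++ TF A :: G2)) B ->
    Mder primed (mplug X (z ++ [:: A], G1 ++ G2)) B
| M_BangR z B : ~~ primed -> Mder primed (z, [::]) B ->
    Mder primed (z, [::]) (Bang B)
| M_BangC X z1 z2 G1 G2 G3 B : ~~ primed -> z2 <> [::] ->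
    Mder primed (mplug X (z1 ++ z2, G1 ++ TB z2 G2 :: G3)) B ->
    Mder primed (mplug X (z1 ++ z2, G1 ++ G2 ++ G3)) B
| M_BangR' z B : primed -> z <> [::] -> Mder primed (z, [::]) B ->
    Mder primed (z, [::]) (Bang B)
| M_BangC' X z1 z2 z' G1 G2 G3 C : primed -> z2 <> [::] ->
    Mder primed (mplug X (z1 ++ z2, G1 ++ TB (z' ++ z2) G2 :: G3)) C ->
    Mder primed (mplug X (z1 ++ z2 ++ z', G1 ++ G2 ++ G3)) C.

Definition M_derivable (Xi : meta) (C : fm) : Prop := Mder false Xi C.
Definition M'_derivable (Xi : meta) (C : fm) : Prop := Mder true Xi C.

Inductive ftm : Type :=
| FF (A : fm)
| FB (g : seq ftm).

Inductive fctx : Type :=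
| FHole
| FBr (l : seq ftm) (c : fctx) (r : seq ftm).

Fixpoint fplug (X : fctx) (m : seq ftm) : seq ftm :=
  match X with
  | FHole => m
  | FBr l c r => l ++ FB (fplug c m) :: r
  end.

Definition is_bang_tm (t : ftm) : Prop := exists A, t = FF (Bang A).

Inductive Fder : seq ftm -> fm -> Prop :=
| F_ax A : Fder [:: FF A] A
| F_one : Fder [::] One
| F_RdL Ga B X D1 C D2 D :
    Fder Ga B -> Fder (fplug X (D1 ++ FF C :: D2)) D ->
    Fder (fplug X (D1 ++ FF (Rd C B) :: Ga ++ D2)) D
| F_RdR Ga B C : Fder (Ga ++ [:: FF B]) C -> Fder Ga (Rd C B)
| F_LdL Ga A X D1 C D2 D :
    Fder Ga A -> Fder (fplug X (D1 ++ FF C :: D2)) D ->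
    Fder (fplug X (D1 ++ Ga ++ FF (Ld A C) :: D2)) D
| F_LdR A Ga C : Fder (FF A :: Ga) C -> Fder Ga (Ld A C)
| F_MulL X D1 A B D2 D :
    Fder (fplug X (D1 ++ FF A :: FF B :: D2)) D ->
    Fder (fplug X (D1 ++ FF (Mul A B) :: D2)) D
| F_MulR De A Ga B : Fder De A -> Fder Ga B -> Fder (De ++ Ga) (Mul A B)
| F_OneL X D1 D2 A :
    Fder (fplug X (D1 ++ D2)) A -> Fder (fplug X (D1 ++ FF One :: D2)) A
| F_AndL1 X D1 A B D2 C :
    Fder (fplug X (D1 ++ FF A :: D2)) C ->
    Fder (fplug X (D1 ++ FF (And A B) :: D2)) C
| F_AndL2 X D1 A B D2 C :
    Fder (fplug X (D1 ++ FF B :: D2)) C ->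
    Fder (fplug X (D1 ++ FF (And A B) :: D2)) C
| F_AndR Xi A B : Fder Xi A -> Fder Xi B -> Fder Xi (And A B)
| F_OrL X D1 A B D2 C :
    Fder (fplug X (D1 ++ FF A :: D2)) C ->
    Fder (fplug X (D1 ++ FF B :: D2)) C ->
    Fder (fplug X (D1 ++ FF (Or A B) :: D2)) C
| F_OrR1 Xi A B : Fder Xi A -> Fder Xi (Or A B)
| F_OrR2 Xi A B : Fder Xi B -> Fder Xi (Or A B)
| F_BoxL X D1 A D2 B :
    Fder (fplug X (D1 ++ FF A :: D2)) B ->
    Fder (fplug X (D1 ++ FB [:: FF (Box A)] :: D2)) B
| F_BoxR Xi A : Fder [:: FB Xi] A -> Fder Xi (Box A)
| F_DiaL X D1 A D2 B :
    Fder (fplug X (D1 ++ FB [:: FF A] :: D2)) B ->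
    Fder (fplug X (D1 ++ FF (Dia A) :: D2)) B
| F_DiaR Xi A : Fder Xi A -> Fder [:: FB Xi] (Dia A)
| F_BangL X D1 A D2 C :
    Fder (fplug X (D1 ++ FF A :: D2)) C ->
    Fder (fplug X (D1 ++ FF (Bang A) :: D2)) C
| F_BangP1 X D1 A Phi D2 C :
    Fder (fplug X (D1 ++ FF (Bang A) :: Phi ++ D2)) C ->
    Fder (fplug X (D1 ++ Phi ++ FF (Bang A) :: D2)) C
| F_BangP2 X D1 A Phi D2 C :
    Fder (fplug X (D1 ++ Phi ++ FF (Bang A) :: D2)) C ->
    Fder (fplug X (D1 ++ FF (Bang A) :: Phi ++ D2)) C
| F_BangR Pi B : Pi <> [::] -> (forall t, List.In t Pi -> is_bang_tm t) ->
    Fder Pi B -> Fder Pi (Bang B)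
| F_BangC X Bs G1 G2 G3 C : Bs <> [::] ->
    (forall t, List.In t Bs -> is_bang_tm t) ->
    Fder (fplug X (Bs ++ G1 ++ FB (Bs ++ G2) :: G3)) C ->
    Fder (fplug X (Bs ++ G1 ++ G2 ++ G3)) C
| F_cut Pi A X G1 G2 C :
    Fder Pi A -> Fder (fplug X (G1 ++ FF A :: G2)) C ->
    Fder (fplug X (G1 ++ Pi ++ G2)) C.

Definition F_derivable (Xi : seq ftm) (C : fm) : Prop := Fder Xi C.

Fixpoint frag1 (A : fm) : Prop :=
  match A with
  | V _ => True
  | Rd b a => frag1 b /\ frag1 a
  | Bang a | Dia a | Box a => frag1 a
  | _ => False
  end.

Fixpoint frag1_nobr (A : fm) : Prop :=
  match A with
  | V _ => True
  | Rd b a => frag1_nobr b /\ frag1_nobr a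
  | Bang a => frag1_nobr a
  | _ => False
  end.

Definition E_frag (G : seq fm) (C : fm) : Prop :=
  (forall A, List.In A G -> frag1_nobr A) /\ frag1_nobr C.

Fixpoint ftm_frag (t : ftm) : Prop :=
  match t with
  | FF A => frag1 A
  | FB g => (fix all_f (l : seq ftm) : Prop :=
               match l with [::] => True | u :: l' => ftm_frag u /\ all_f l' end) g
  end.

Definition F_frag (Xi : seq ftm) (C : fm) : Prop :=
  (forall t, List.In t Xi -> ftm_frag t) /\ frag1 C.

Fixpoint tm_frag (t : tm) : Prop :=
  match t with
  | TF A => frag1 A
  | TB z g => (forall A, List.In A z -> frag1 A) /\
      (fix all_t (l : seq tm) : Prop :=
         match l with [::] => True | u :: l' => tm_frag u /\ all_t l' end) g
  end.

Definition M_frag (Xi : meta) (C : fm) : Prop :=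
  (forall A, List.In A Xi.1 -> frag1 A) /\
  (forall t, List.In t Xi.2 -> tm_frag t) /\ frag1 C.

(* sequents are encoded injectively into GenTree.tree nat and then
   into nat by the (computable) [pickle] of mathcomp's choice.v *)
Fixpoint enc_fm (A : fm) : GenTree.tree nat :=
  match A with
  | V n => GenTree.Node 0 [:: GenTree.Leaf n]
  | One => GenTree.Node 1 [::]
  | Ld a b => GenTree.Node 2 [:: enc_fm a; enc_fm b]
  | Rd b a => GenTree.Node 3 [:: enc_fm b; enc_fm a]
  | Mul a b => GenTree.Node 4 [:: enc_fm a; enc_fm b]
  | And a b => GenTree.Node 5 [:: enc_fm a; enc_fm b]
  | Or a b => GenTree.Node 6 [:: enc_fm a; enc_fm b]
  | Dia a => GenTree.Node 7 [:: enc_fm a]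
  | Box a => GenTree.Node 8 [:: enc_fm a]
  | Bang a => GenTree.Node 9 [:: enc_fm a]
  end.

Fixpoint enc_tm (t : tm) : GenTree.tree nat :=
  match t with
  | TF A => GenTree.Node 0 [:: enc_fm A]
  | TB z g => GenTree.Node 1 [:: GenTree.Node 0 (map enc_fm z);
                                 GenTree.Node 0 (map enc_tm g)]
  end.

Fixpoint enc_ftm (t : ftm) : GenTree.tree nat :=
  match t with
  | FF A => GenTree.Node 0 [:: enc_fm A]
  | FB g => GenTree.Node 1 [:: GenTree.Node 0 (map enc_ftm g)]
  end.

Definition code_E (s : seq fm * fm) : nat :=
  pickle (GenTree.Node 0 [:: GenTree.Node 0 (map enc_fm s.1); enc_fm s.2]).

Definition code_F (s : seq ftm * fm) : nat :=
  pickle (GenTree.Node 0 [:: GenTree.Node 0 (map enc_ftm s.1); enc_fm s.2]).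

Definition code_M (s : meta * fm) : nat :=
  pickle (GenTree.Node 0 [:: GenTree.Node 0 (map enc_fm s.1.1);
                            GenTree.Node 0 (map enc_tm s.1.2); enc_fm s.2]).

Inductive instr : Type :=
| INC (r : nat)
| DEC (r : nat) (j : nat).

Definition cmachine := seq instr.
Definition config := (nat * (nat -> nat))%type.

Definition upd (R : nat -> nat) (r v : nat) : nat -> nat :=
  fun x => if x == r then v else R x.

Definition step (M : cmachine) (c : config) : config :=
  let: (pc, R) := c in
  if pc < size M then
    match nth (INC 0) M pc with
    | INC r => (pc.+1, upd R r (R r).+1)
    | DEC r j => if R r == 0 then (j, R) else (pc.+1, upd R r (R r).-1)
    end
  else c.

Definition run (M : cmachine) (k : nat) (c : config) : config :=
  iter k (step M) c.

Definition init (n : nat) : config := (0, fun r => if r == 0 then n else 0).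

Definition cm_decidable (S : Type) (code : S -> nat) (D P : S -> Prop) : Prop :=
  exists M : cmachine, forall s, D s ->
    exists k, let c := run M k (init (code s)) in
      size M <= c.1 /\ (P s <-> c.2 0 = 1).

(* Main.v *)
(** All five calculi simulate a counter machine by a queue automaton whose
    transitions are exponentiated one-division formulae.  The antecedent, apart
    from these formulae, is a queue of letters, one per unit in a register, and the
    succedent is the control state: [!((q / b) / x)] lets [x] be deleted at the
    front when passing from [q] to [b], and [!(q / (b / x))] appends [x] at the
    rear.  A decrement rotates the queue once around a marker.  In the bracketed
    calculi the transitions become [![]^{-1}A], so that contraction, which creates
    a bracket, can be followed by the removal of that bracket.  As there is no
    weakening, one extra formula finally consumes one copy of each transition.

    Conversely, erasing brackets maps each calculus into E, and E (with cut) is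
    sound for languages over a free monoid, where [!A] denotes the empty word if
    [A] contains it, and nothing otherwise; a state denotes the queues from which
    the machine halts.

    The Goedel number of the sequent for the machine [M] and the input [n] is
    obtained from the number [N] of its part depending only on [M] by [n] iterations
    of one affine map, followed by another one.  A machine can therefore compute the
    number of its own sequent on the input [n = N], run an alleged decider on
    it and do the opposite of the answer. *)

From Stdlib Require Import Permutation FunctionalExtensionality.
Require Import Defs.
From mathcomp Require Import all_boot zify.

Set Implicit Arguments.
Unset Strict Implicit.
Unset Printing Implicit Defensive.

(** * Counter machines *)

Definition reach (P : cmachine) (c c' : config) : Prop :=
  exists k, run P k c = c'.

Definition halts (P : cmachine) (c : config) : Prop :=
  exists k, size P <= (run P k c).1.

Lemma run_add P j k c : run P (j + k) c = run P j (run P k c).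
Proof. exact: iterD. Qed.

Lemma reach_refl P c : reach P c c.
Proof. by exists 0. Qed.

Lemma reach_trans P c1 c2 c3 : reach P c1 c2 -> reach P c2 c3 -> reach P c1 c3.
Proof. by move=> [j <-] [k <-]; exists (k + j); rewrite run_add. Qed.

Lemma reach_step P c c' : step P c = c' -> reach P c c'.
Proof. by move=> <-; exists 1. Qed.

Lemma step_out P c : size P <= c.1 -> step P c = c.
Proof. by case: c => pc R /=; rewrite leqNgt => /negbTE ->. Qed.

Lemma run_out P k c : size P <= c.1 -> run P k c = c.
Proof. by move=> h; elim: k => //= k ->; exact: step_out. Qed.

(** A halted configuration is a fixed point of [step], so overshooting the halting time is harmless
    and both runs can be compared after [j + k] steps. *)
Lemma halts_reach P c c' : reach P c c' -> halts P c <-> halts P c'.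
Proof.
move=> [k <-]; split=> [[j hj]|[j hj]]; last by exists (j + k); rewrite run_add.
exists j; rewrite -run_add addnC run_add run_out //.
Qed.

Lemma step_INC P pc R r : pc < size P -> nth (INC 0) P pc = INC r ->
  step P (pc, R) = (pc.+1, upd R r (R r).+1).
Proof. by move=> /= -> ->. Qed.

Lemma step_DEC P pc R r j : pc < size P -> nth (INC 0) P pc = DEC r j ->
  step P (pc, R) = if R r == 0 then (j, R) else (pc.+1, upd R r (R r).-1).
Proof. by move=> /= -> ->. Qed.

Lemma updE R r v x : upd R r v x = if x == r then v else R x.
Proof. by []. Qed.

Lemma upd_id R r : upd R r (R r) = R.
Proof. by apply: functional_extensionality => x; rewrite updE; case: eqP => // ->. Qed.

Lemma upd_upd R r v w : upd (upd R r v) r w = upd R r w.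
Proof. by apply: functional_extensionality => x; rewrite !updE; case: eqP. Qed.

(** * A loop language and its compilation to counter machines *)

Inductive cmd : Type :=
| CInc (r : nat)
| CLoop (r : nat) (c : cmd)
| CSeq (c d : cmd).

Fixpoint exec (c : cmd) (R : nat -> nat) : nat -> nat :=
  match c with
  | CInc r => upd R r (R r).+1
  | CLoop r c => iter (R r) (fun S => exec c (upd S r (S r).-1)) R
  | CSeq c d => exec d (exec c R)
  end.

Fixpoint writes (c : cmd) : seq nat :=
  match c with
  | CInc r => [:: r]
  | CLoop r c => r :: writes c
  | CSeq c d => writes c ++ writes d
  end.

(** The body may not write to the loop counter: then testing the counter before each round, as the
    machine does, yields the number of rounds that [exec] fixes on entry. *)
Fixpoint wf_cmd (c : cmd) : bool :=
  match c with
  | CInc _ => true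
  | CLoop r c => (r \notin writes c) && wf_cmd c
  | CSeq c d => wf_cmd c && wf_cmd d
  end.

(* Register [z] is kept at zero, so that [DEC z] is an unconditional jump. *)
Fixpoint compile (z off : nat) (c : cmd) : cmachine :=
  match c with
  | CInc r => [:: INC r]
  | CLoop r c =>
      let b := compile z off.+1 c in
      DEC r (off + size b).+2 :: b ++ [:: DEC z off]
  | CSeq c d =>
      let b := compile z off c in b ++ compile z (off + size b) d
  end.

Lemma exec_writes c R x : x \notin writes c -> exec c R x = R x.
Proof.
elim: c R => [r|r c IH|c IHc d IHd] R /=.
- by rewrite inE updE => /negbTE ->.
- rewrite inE negb_or => /andP[xr xc]; move: (R r) => n.
  by elim: n => //= n IHn; rewrite IH // updE (negbTE xr).
- by rewrite mem_cat negb_or => /andP[xc xd]; rewrite IHd // IHc.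
Qed.

Definition at_off (P : cmachine) (off : nat) (b : cmachine) : Prop :=
  exists pre post, P = pre ++ b ++ post /\ size pre = off.

Lemma at_off_catl P off b b' : at_off P off (b ++ b') -> at_off P off b.
Proof. by move=> [p [q [-> <-]]]; exists p, (b' ++ q); rewrite !catA. Qed.

Lemma at_off_catr P off b b' : at_off P off (b ++ b') -> at_off P (off + size b) b'.
Proof.
by move=> [p [q [-> <-]]]; exists (p ++ b), q; rewrite size_cat !catA.
Qed.

Lemma at_off_nth P off b i : at_off P off b -> i < size b ->
  off + i < size P /\ nth (INC 0) P (off + i) = nth (INC 0) b i.
Proof.
move=> [p [q [-> <-]]] ib; split.
  by rewrite !size_cat ltn_add2l ltn_addr.
by rewrite nth_cat ltnNge leq_addr /= addKn nth_cat ib.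
Qed.

Lemma at_off_head P off i b : at_off P off (i :: b) ->
  off < size P /\ nth (INC 0) P off = i.
Proof. by move=> /at_off_nth/(_ (ltn0Sn _)); rewrite addn0. Qed.

Lemma compile_correct P z off c R :
  at_off P off (compile z off c) -> wf_cmd c -> z \notin writes c -> R z = 0 ->
  reach P (off, R) (off + size (compile z off c), exec c R).
Proof.
elim: c off R => [r|r c IH|c IHc d IHd] off R /=.
- move=> /at_off_head[lt e] _ _ _; apply: reach_step.
  by rewrite (step_INC R lt e) addn1.
- set b := compile _ _ _ => hP /andP[rc wc]; rewrite inE negb_or => /andP[zr zc].
  have [lt e] := at_off_head hP.
  have hP1 : at_off P off.+1 (b ++ [:: DEC z off]).
    by move: hP; rewrite -cat1s => /at_off_catr; rewrite addn1.
  have [lt2 e2] := at_off_head (at_off_catr hP1).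
  have szE : off + (size (b ++ [:: DEC z off])).+1 = (off + size b).+2.
    by rewrite size_cat /= addn1 !addnS.
  rewrite szE.
  have loop n S : S r = n -> S z = 0 ->
      reach P (off, S) ((off + size b).+2,
        iter n (fun S => exec c (upd S r (S r).-1)) S).
    elim: n S => [|n IHn] S Sr Sz.
      by apply: reach_step; rewrite (step_DEC S lt e) Sr.
    apply: (@reach_trans _ _ (off.+1, upd S r (S r).-1)).
      by apply: reach_step; rewrite (step_DEC S lt e) Sr.
    set S1 := upd S r _; have S1z : S1 z = 0 by rewrite /S1 updE (negbTE zr).
    apply: (reach_trans (IH _ _ (at_off_catl hP1) wc zc S1z)).
    have S2z : exec c S1 z = 0 by rewrite exec_writes.
    apply: (@reach_trans _ _ (off, exec c S1)).
      by apply: reach_step; rewrite (step_DEC _ lt2 e2) S2z.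
    rewrite iterSr; apply: IHn => //.
    by rewrite exec_writes // /S1 updE eqxx Sr.
  by move=> Rz; exact: loop.
- set b := compile _ _ _ => hP /andP[wc wd]; rewrite mem_cat negb_or => /andP[zc zd] Rz.
  apply: reach_trans (IHc _ _ (at_off_catl hP) wc zc Rz) _.
  rewrite size_cat addnA; apply: IHd => //; first exact: at_off_catr hP.
  by rewrite exec_writes.
Qed.

(** Halting of the copy must pass control to the code behind it, so every jump out of [M] is
    redirected to the first address after the copy. *)
Definition relocate (off : nat) (M : cmachine) : cmachine :=
  [seq match i with
       | INC r => INC r
       | DEC r j => DEC r (off + minn j (size M))
       end | i <- M].

Lemma relocate_correct P off M k pc R :
  at_off P off (relocate off M) -> size M <= (run M k (pc, R)).1 ->
  reach P (off + minn pc (size M), R) (off + size M, (run M k (pc, R)).2).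
Proof.
move=> hP; have szr : size (relocate off M) = size M by rewrite size_map.
elim: k pc R => [|k IH] pc R /=.
  by move=> /minn_idPr ->; exact: reach_refl.
rewrite /run -iterS iterSr -/(run M k _).
case: (ltnP pc (size M)) => [lt|ge]; last first.
  by rewrite step_out // => /IH; rewrite (minn_idPr ge).
have [lt1 e1] : off + pc < size P /\ nth (INC 0) P (off + pc) =
    nth (INC 0) (relocate off M) pc by apply: at_off_nth; rewrite ?szr.
rewrite (nth_map (INC 0)) // in e1.
have mS : minn pc.+1 (size M) = pc.+1 by exact/minn_idPl.
case ei: (nth (INC 0) M pc) e1 => [r|r j] e1.
  rewrite (step_INC R lt ei) => /IH; apply: reach_trans.
  by apply: reach_step; rewrite (step_INC R lt1 e1) mS addnS.
rewrite (step_DEC R lt ei) => h.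
apply: (@reach_trans _ _ (if R r == 0 then (off + minn j (size M), R)
           else (off + pc.+1, upd R r (R r).-1))).
  by apply: reach_step; rewrite (step_DEC R lt1 e1) addnS.
by move: h; case: ifP => _ /IH; rewrite ?mS.
Qed.

(** * The diagonal argument *)

Definition regs3 (a b c : nat) : nat -> nat :=
  fun x => if x == 0 then a else if x == 1 then b else if x == 2 then c else 0.

Lemma upd_regs3_0 a b c v : upd (regs3 a b c) 0 v = regs3 v b c.
Proof. by apply: functional_extensionality => -[|x]. Qed.
Lemma upd_regs3_1 a b c v : upd (regs3 a b c) 1 v = regs3 a v c.
Proof. by apply: functional_extensionality => -[|[|x]]. Qed.
Lemma upd_regs3_2 a b c v : upd (regs3 a b c) 2 v = regs3 a b v.
Proof. by apply: functional_extensionality => -[|[|[|x]]]. Qed.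
Definition upd_regs3 := (upd_regs3_0, upd_regs3_1, upd_regs3_2).

(* Register 4 stays at zero, so that the base case is a no-op. *)
Fixpoint c_add (m r : nat) : cmd :=
  if m is m'.+1 then CSeq (CInc r) (c_add m' r) else CLoop 4 (CInc 5).

Lemma exec_c_add m a b c : exec (c_add m 2) (regs3 a b c) = regs3 a b (c + m).
Proof.
elim: m c => [|m IH] c /=; first by rewrite addn0.
by rewrite upd_regs3 IH addSnnS.
Qed.

Lemma writes_c_add m x : x \in writes (c_add m 2) -> x \in [:: 2; 4; 5].
Proof.
elim: m => [|m IH] /=; first by rewrite !inE => /orP[] ->; rewrite ?orbT.
by rewrite inE => /orP[/eqP ->|/IH].
Qed.

Lemma wf_c_add m : wf_cmd (c_add m 2).
Proof. by elim: m. Qed.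

Definition c_affine (A B : nat) : cmd :=
  CSeq (CLoop 0 (c_add A 2)) (CSeq (c_add B 2) (CLoop 2 (CInc 0))).

Lemma exec_c_affine A B a b :
  exec (c_affine A B) (regs3 a b 0) = regs3 (A * a + B) b 0.
Proof.
rewrite /=; have -> : iter (regs3 a b 0 0)
    (fun S => exec (c_add A 2) (upd S 0 (S 0).-1)) (regs3 a b 0) =
    regs3 0 b (A * a).
  have gen n c : iter n (fun S => exec (c_add A 2) (upd S 0 (S 0).-1))
      (regs3 n b c) = regs3 0 b (c + A * n).
    elim: n c => [|n IH] c; first by rewrite muln0 addn0.
    by rewrite iterSr upd_regs3 exec_c_add IH -addnA -mulnS.
  by rewrite gen.
rewrite exec_c_add; move: (_ + B) => m.
have gen n a' : iter n (fun S => upd (upd S 2 (S 2).-1) 0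
     (upd S 2 (S 2).-1 0).+1) (regs3 a' b n) = regs3 (a' + n) b 0.
  elim: n a' => [|n IH] a'; first by rewrite addn0.
  by rewrite iterSr !upd_regs3 /= IH addSnnS.
by rewrite gen.
Qed.

(** The argument is copied into registers 1 and 2 and restored from 2, since it is both the starting
    value and the number of iterations. *)
Definition c_diag (A B A' B' : nat) : cmd :=
  CSeq (CLoop 0 (CSeq (CInc 1) (CInc 2)))
 (CSeq (CLoop 2 (CInc 0))
 (CSeq (CLoop 1 (c_affine A B)) (c_affine A' B'))).

Lemma exec_c_diag A B A' B' n :
  exec (c_diag A B A' B') (regs3 n 0 0) =
  regs3 (A' * iter n (fun x => A * x + B) n + B') 0 0.
Proof.
rewrite /c_diag; cbn [exec].
have gen1 m b c : iter m (fun S => exec (CInc 2) (exec (CInc 1)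
    (upd S 0 (S 0).-1))) (regs3 m b c) = regs3 0 (b + m) (c + m).
  elim: m b c => [|m IH] b c; first by rewrite !addn0.
  by rewrite iterSr /= !upd_regs3 IH !addSnnS.
rewrite gen1 !add0n.
have gen2 m a b : iter m (fun S => exec (CInc 0) (upd S 2 (S 2).-1))
    (regs3 a b m) = regs3 (a + m) b 0.
  elim: m a => [|m IH] a; first by rewrite addn0.
  by rewrite iterSr /= !upd_regs3 IH addSnnS.
rewrite gen2 add0n.
have gen3 m a : iter m (fun S => exec (c_affine A B) (upd S 1 (S 1).-1))
    (regs3 a m 0) = regs3 (iter m (fun x => A * x + B) a) 0 0.
  elim: m a => [|m IH] a //.
  by rewrite iterSr upd_regs3 exec_c_affine IH -iterSr.
by rewrite gen3 exec_c_affine.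
Qed.

Lemma writes_c_affine A B x : x \in writes (c_affine A B) -> x \in [:: 0; 2; 4; 5].
Proof.
rewrite /= inE !mem_cat => /or3P[/eqP -> //|/writes_c_add|/orP[/writes_c_add|]].
all: by rewrite !inE => /or3P[] /eqP -> || by rewrite !inE => /orP[] /eqP ->.
Qed.

Lemma wf_c_affine A B : wf_cmd (c_affine A B).
Proof.
by rewrite /= !wf_c_add !andbT; apply/negP => /writes_c_add.
Qed.

Lemma wf_c_diag A B A' B' : wf_cmd (c_diag A B A' B').
Proof.
have h1 : 1 \notin writes (c_affine A B) by apply/negP => /writes_c_affine.
by rewrite /c_diag; cbn [wf_cmd]; rewrite !wf_c_affine h1.
Qed.

Lemma c_diag_fresh A B A' B' : 3 \notin writes (c_diag A B A' B').
Proof.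
have h3 a b : 3 \notin writes (c_affine a b) by apply/negP => /writes_c_affine.
rewrite /c_diag; cbn [writes].
by rewrite mem_cat negb_or mem_cat negb_or mem_cat negb_or inE negb_or !h3.
Qed.

Lemma halts_self_jump P pc R : pc < size P -> nth (INC 0) P pc = DEC 0 pc ->
  R 0 = 0 -> ~ halts P (pc, R).
Proof.
move=> lt e R0 [k]; suff -> : run P k (pc, R) = (pc, R) by rewrite leqNgt lt.
by elim: k => //= k ->; rewrite (step_DEC R lt e) R0.
Qed.

(* The last two instructions diverge exactly when the decider has answered 1. *)
Definition flip (p M : cmachine) : cmachine :=
  let e := size p + size M in
  p ++ relocate (size p) M ++ [:: DEC 0 e.+2; DEC 0 e.+1].

Lemma flip_halts p M k c R :
  reach (flip p M) c (size p, R) -> size M <= (run M k (0, R)).1 ->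
  (halts (flip p M) c <-> (run M k (0, R)).2 0 <> 1).
Proof.
set P := flip p M; move=> hp hM.
pose e := size p + size M; pose post := [:: DEC 0 e.+2; DEC 0 e.+1].
have szP : size P = e.+2.
  by rewrite /P /flip !size_cat size_map /= addnA addn2.
have at1 : at_off P (size p) (relocate (size p) M) by exists p, post.
have at2 : at_off P e post.
  exists (p ++ relocate (size p) M), [::].
  by rewrite cats0 -catA size_cat size_map.
have := relocate_correct at1 hM.
rewrite min0n addn0 => /(reach_trans hp) r1; rewrite (halts_reach r1) -/e.
have [lt1 e1] := at_off_nth at2 (isT : 0 < 2).
have [lt2 e2] := at_off_nth at2 (isT : 1 < 2).
rewrite /= ?addn0 ?addn1 in lt1 e1 lt2 e2.
(* [S] is what the decider leaves. Answer 0 exits through the first test, answer 1 is decremented to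
   0 and caught in the self-jump, and a larger answer survives both decrements and runs off the
   end. *)
move: (run M k (0, R)).2 => S; case: (posnP (S 0)) => [S0|Sp].
  split=> [_|_]; first by rewrite S0.
  by exists 1; rewrite /run iterS (step_DEC S lt1 e1) S0 szP.
have s1 : reach P (e, S) (e.+1, upd S 0 (S 0).-1).
  by apply: reach_step; rewrite (step_DEC S lt1 e1) eqn0Ngt Sp.
rewrite (halts_reach s1); case: (eqVneq (S 0) 1) => [S1|S1].
  split=> [|//]; move=> h; exfalso; apply: (halts_self_jump lt2 e2) h.
  by rewrite updE S1.
split=> [_|_]; first exact/eqP.
exists 1; rewrite /run iterS (step_DEC _ lt2 e2) updE eqxx szP.
by case: (S 0) Sp S1 => [|[|m]].
Qed.

Lemma initE m : init m = (0, regs3 m 0 0).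
Proof. by congr (_, _); apply: functional_extensionality => -[|[|[|x]]]. Qed.

(** The coefficients are chosen before [Q], so the preparatory program [p] is written without
    knowing [N]. The number [N] is then read off the finished machine [flip p M] and supplied to it
    as input. *)
Lemma diagonal (S : Type) (code : S -> nat) (D P : S -> Prop)
    (mk : cmachine -> nat -> S) (A B A' B' : nat) :
  (forall Q, exists N, forall n,
     code (mk Q n) = A' * iter n (fun x => A * x + B) N + B') ->
  (forall Q n, D (mk Q n)) ->
  (forall Q n, P (mk Q n) <-> halts Q (init n)) ->
  ~ cm_decidable code D P.
Proof.
move=> hcode hD hP [M hM]; pose p := compile 3 0 (c_diag A B A' B').
have [N hN] := hcode (flip p M); have [k [hk ans]] := hM _ (hD (flip p M) N).
rewrite hN initE in hk ans.
have hp : reach (flip p M) (init N)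
    (size p, regs3 (A' * iter N (fun x => A * x + B) N + B') 0 0).
  rewrite -exec_c_diag initE; apply: compile_correct (c_diag_fresh _ _ _ _) _ => //.
    by exists [::], (relocate (size p) M ++
      [:: DEC 0 (size p + size M).+2; DEC 0 (size p + size M).+1]).
  exact: wf_c_diag.
have := flip_halts hp hk; move: (hP (flip p M) N); tauto.
Qed.

(** * Goedel numbers of sequents *)

(** Prepending a token [n] acts on the code [m] of the rest as the affine map from [m] to
    [2 ^ n * (2 * m + 1)], and affine maps compose. *)
Lemma foldr_affine (s : seq nat) : exists A B, forall x,
  foldr (fun n m => 2 ^ n * m.*2.+1) x s = A * x + B.
Proof.
elim: s => [|n s [A [B IH]]]; first by exists 1, 0 => x; rewrite mul1n addn0.
exists (2 ^ n * A.*2), (2 ^ n * B.*2.+1) => x /=.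
rewrite IH -mulnA -mulnDr; congr (_ * _); lia.
Qed.

Definition tokens (t : GenTree.tree nat) : seq nat := map pickle (GenTree.encode t).

Definition ftokens (f : seq (GenTree.tree nat)) : seq nat := flatten (map tokens f).

Definition opening (k : nat) : nat := pickle (inl k.+1 : nat + nat)%type.
Definition closing : nat := pickle (inl 0 : nat + nat)%type.

Lemma tokens_node k f :
  tokens (GenTree.Node k f) = [:: opening k] ++ ftokens f ++ [:: closing].
Proof.
rewrite /tokens [GenTree.encode _]/= [map pickle (_ :: _)]/= map_rcons -cats1.
by rewrite map_flatten -map_comp.
Qed.

Lemma ftokens_cons t f : ftokens (t :: f) = tokens t ++ ftokens f.
Proof. by []. Qed.

Lemma pickle_tokens (t : GenTree.tree nat) :
  pickle t = foldr (fun n m => 2 ^ n * m.*2.+1) 0 (tokens t).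
Proof. by []. Qed.

(** Each copy of [rep] contributes one application of the same map, and [pre] contributes the outer
    map. Only [suf] sees the machine, and its code is [N]. *)
Lemma code_affine (S : Type) (code : S -> nat) (pre rep : seq nat)
    (mk : cmachine -> nat -> S) (suf : cmachine -> seq nat) :
  (forall Q n, code (mk Q n) = foldr (fun n m => 2 ^ n * m.*2.+1) 0
     (pre ++ flatten (nseq n rep) ++ suf Q)) ->
  exists A B A' B', forall Q, exists N, forall n,
     code (mk Q n) = A' * iter n (fun x => A * x + B) N + B'.
Proof.
move=> h; have [A [B hA]] := foldr_affine rep; have [A' [B' hA']] := foldr_affine pre.
exists A, B, A', B' => Q.
exists (foldr (fun n m => 2 ^ n * m.*2.+1) 0 (suf Q)) => n.
rewrite h !foldr_cat hA'; congr (_ * _ + _).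
by elim: n => //= n IH; rewrite foldr_cat IH hA.
Qed.

(** * Encoding of counter machines *)

Lemma in_catP T (x : T) s t : List.In x (s ++ t) <-> List.In x s \/ List.In x t.
Proof. exact: List.in_app_iff. Qed.

Lemma in_mapP S T (f : S -> T) y s :
  List.In y (map f s) <-> exists x, f x = y /\ List.In x s.
Proof. exact: List.in_map_iff. Qed.

Lemma in_memP (T : eqType) (x : T) s : List.In x s <-> x \in s.
Proof.
elim: s => //= y s ->; rewrite inE eq_sym; split.
  by move=> [-> | ->]; rewrite ?eqxx ?orbT.
by move=> /orP[/eqP|]; auto.
Qed.

Lemma in_flattenP T (x : T) ss :
  List.In x (flatten ss) <-> exists s, List.In s ss /\ List.In x s.
Proof.
elim: ss => [|s ss IH] /=; first by split=> // -[s []].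
rewrite in_catP IH; split=> [[h|[t [h1 h2]]]|[t [[<-|h1] h2]]]; auto.
- by exists s; auto.
- by exists t; auto.
- by right; exists t.
Qed.

(** Variables are sorted by their index modulo 5: 0 for letters, 1 for states, 2 and 3 for the
    phases of a decrement, 4 for the marker [hash] and the final state [fin]. In phase [seek] a
    letter of the register is looked for; phase [wind] completes the rotation after its removal. *)
Definition hash : fm := V 4.
Definition fin : fm := V 9.
Definition ltr (r : nat) : fm := V (r * 5).
Definition st (p : nat) : fm := V (p * 5).+1.
Definition seek (p : nat) : fm := V (p * 5).+2.
Definition wind (p : nat) : fm := V (p * 5).+3.

(* With a word as antecedent and a state as succedent, the word is a queue:
   [pop x b q] goes from state [q] to state [b] deleting [x] at the front,
   [push q b x] goes from [q] to [b] appending [x] at the rear. *)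
Definition pop (x b q : fm) : fm := Rd (Rd q b) x.
Definition push (q b x : fm) : fm := Rd q (Rd b x).
(** The intermediate goal [q / x] gives back, by the right rule for [/], the letter just deleted:
    the front letter moves to the rear. *)
Definition rot (q x : fm) : fm := pop x (Rd q x) q.

Definition reg_of (i : instr) : nat :=
  match i with INC r => r | DEC r _ => r end.
(** Register 0 is included because it carries the input even when [M] never mentions it. *)
Definition regs (M : cmachine) : seq nat := 0 :: map reg_of M.

(** A decrement puts the marker at the rear and rotates. If the marker reaches the front before a
    letter [r], the register is zero; otherwise the first [r] is deleted and [wind] restores the
    order. Jump targets are clamped to [size M], the only state with an exit to [fin]. *)
Definition instr_rules (M : cmachine) (p : nat) (i : instr) : seq fm :=
  match i with
  | INC r => [:: push (st p) (st p.+1) (ltr r)]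
  | DEC r j =>
      [:: push (st p) (seek p) hash;
          pop hash (st (minn j (size M))) (seek p);
          pop (ltr r) (wind p) (seek p);
          pop hash (st p.+1) (wind p)] ++
      [seq rot (seek p) (ltr s) | s <- regs M & s != r] ++
      [seq rot (wind p) (ltr s) | s <- regs M]
  end.

Definition rules (M : cmachine) : seq fm :=
  [:: Rd (st (size M)) fin] ++ [seq pop (ltr s) fin fin | s <- regs M] ++
  flatten [seq instr_rules M p (nth (INC 0) M p) | p <- iota 0 (size M)].

(* Consumes one copy of each formula of [s], in the absence of weakening. *)
Definition collect (s : seq fm) : fm := foldr (fun A B => Rd B A) fin s.

(** [wr] is the identity for the bracket-free calculi and [Box] for the bracketed ones. *)
Definition program (wr : fm -> fm) (M : cmachine) : seq fm :=
  collect (map wr (rules M)) :: map wr (rules M).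

Definition antecedent (wr : fm -> fm) (M : cmachine) (n : nat) : seq fm :=
  nseq n (ltr 0) ++ map Bang (program wr M).

Lemma rules_ind (M : cmachine) (P : fm -> Prop) :
  P (Rd (st (size M)) fin) ->
  (forall s, s \in regs M -> P (pop (ltr s) fin fin)) ->
  (forall p r, p < size M -> nth (INC 0) M p = INC r ->
     P (push (st p) (st p.+1) (ltr r))) ->
  (forall p r j, p < size M -> nth (INC 0) M p = DEC r j ->
     [/\ P (push (st p) (seek p) hash),
         P (pop hash (st (minn j (size M))) (seek p)),
         P (pop (ltr r) (wind p) (seek p)),
         P (pop hash (st p.+1) (wind p)) &
         (forall s, s \in regs M -> s != r -> P (rot (seek p) (ltr s))) /\
         (forall s, s \in regs M -> P (rot (wind p) (ltr s)))]) ->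
  forall A, List.In A (rules M) -> P A.
Proof.
move=> Pend Ppop Pinc Pdec A /in_catP[[<- //|[]]|/in_catP[]].
  by move=> /in_mapP[s [<- /(proj1 (in_memP _ _)) hs]]; exact: Ppop.
move=> /in_flattenP[l [/in_mapP[p [<- /(proj1 (in_memP _ _))]]]].
rewrite mem_iota add0n => /andP[_ lt]; case e: (nth _ _ _) => [r|r j];
  rewrite /instr_rules.
  by move=> [<-|[]]; exact: Pinc.
have [P1 P2 P3 P4 [P5 P6]] := Pdec _ _ _ lt e.
move=> /in_catP[[<- //|[<- //|[<- //|[<- //|[]]]]]|/in_catP[]].
all: move=> /in_mapP[s [<- /(proj1 (in_memP _ _))]].
  by rewrite mem_filter => /andP[? ?]; exact: P5.
exact: P6.
Qed.

Lemma rules_instr M p A : p < size M ->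
  List.In A (instr_rules M p (nth (INC 0) M p)) -> List.In A (rules M).
Proof.
move=> lt h; apply/in_catP; right; apply/in_catP; right; apply/in_flattenP.
exists (instr_rules M p (nth (INC 0) M p)); split=> //.
by apply/in_mapP; exists p; split=> //; apply/in_memP; rewrite mem_iota.
Qed.

Lemma frag_program wr M :
  (forall A, frag1_nobr A -> frag1 (wr A)) ->
  forall A, List.In A (program wr M) -> frag1 A.
Proof.
move=> hwr; have h : forall A, List.In A (map wr (rules M)) -> frag1 A.
  by move=> B /in_mapP[A [<-]] hA; apply: hwr; move: A hA; apply: rules_ind => //=.
move=> A [<-|/h //]; elim: (map wr _) h => //= B l IH h; split; last by apply: h; left.
by apply: IH => C hC; apply: h; right.
Qed.

Lemma frag_nobr_program M A : List.In A (program id M) -> frag1_nobr A.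
Proof.
have h : forall A, List.In A (rules M) -> frag1_nobr A by apply: rules_ind => //=.
rewrite /program map_id; move=> [<-|/h //].
elim: (rules M) h => //= B l IH h; split; last by apply: h; left.
by apply: IH => C hC; apply: h; right.
Qed.

Lemma nobr_frag A : frag1_nobr A -> nobr A.
Proof. by elim: A => //= A IHA B IHB [/IHA ? /IHB ?]. Qed.

(** * Soundness: languages over a free monoid *)

Section Model.
Variable v : nat -> seq nat -> Prop.

Fixpoint sem (A : fm) (w : seq nat) : Prop :=
  match A with
  | V n => v n w
  | One => w = [::]
  | Ld A B => forall x, sem A x -> sem B (x ++ w)
  | Rd B A => forall x, sem A x -> sem B (w ++ x)
  | Mul A B => exists x y, [/\ w = x ++ y, sem A x & sem B y]
  | And A B => sem A w /\ sem B w
  | Or A B => sem A w \/ sem B w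
  | Dia A | Box A => sem A w
  | Bang A => w = [::] /\ sem A [::]
  end.

Fixpoint den (G : seq fm) (w : seq nat) : Prop :=
  if G is A :: G' then exists x y, [/\ w = x ++ y, sem A x & den G' y]
  else w = [::].

Lemma den_cat G H w :
  den (G ++ H) w <-> exists x y, [/\ w = x ++ y, den G x & den H y].
Proof.
elim: G w => [|A G IH] w /=.
  by split=> [h|[x [y [-> -> //]]]]; exists [::], w.
split=> [[x [y [-> hx /IH[z [t [-> hz ht]]]]]]|[x [y [-> [z [t [-> hz ht]]] hy]]]].
  by exists (x ++ z), t; split; rewrite ?catA //; exists x, z.
exists z, (t ++ y); split; rewrite ?catA //; apply/IH; by exists t, y.
Qed.

Lemma den1 A w : den [:: A] w <-> sem A w.
Proof.
split=> [[x [y [-> hx ->]]]|h]; first by rewrite cats0.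
by exists w, [::]; rewrite cats0.
Qed.

(** A banged formula contributes only the empty word, so it amounts to a side condition independent
    of its place: this validates permutation, contraction and weakening alike. *)
Lemma den_bang D1 A D2 w :
  den (D1 ++ Bang A :: D2) w <-> sem A [::] /\ den (D1 ++ D2) w.
Proof.
split=> [/den_cat[x [y [-> hx [z [t [-> [-> hA] ht]]]]]]|[hA /den_cat[x [y [-> hx hy]]]]].
  by split=> //; apply/den_cat; exists x, t.
by apply/den_cat; exists x, y; split=> //; exists [::], y.
Qed.

Lemma den_bangs G w : (forall X, List.In X G -> is_bang X) -> den G w -> w = [::].
Proof.
elim: G w => //= A G IH w h [x [y [-> hx hy]]].
have [B eB] := h _ (or_introl erefl); rewrite eB in hx.
by case: hx => -> _; apply: IH hy => X hX; apply: h; right.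
Qed.

Definition entails (G H : seq fm) : Prop := forall w, den G w -> den H w.

Lemma entails_ctx D1 G H D2 : entails G H -> entails (D1 ++ G ++ D2) (D1 ++ H ++ D2).
Proof.
move=> h w /den_cat[x [y [-> hx /den_cat[z [t [-> hz ht]]]]]].
apply/den_cat; exists x, (z ++ t); split=> //.
by apply/den_cat; exists z, t; split=> //; exact: h.
Qed.

Lemma E_sound b G C w : Eder b G C -> den G w -> sem C w.
Proof.
move=> h; elim: {G C} h w => /=.
- by move=> A _ w /den1.
- by [].
- move=> Pi A B D1 D2 C _ IH1 _ IH2 w hw; apply: IH2.
  move: w hw; have := @entails_ctx D1 (Pi ++ [:: Ld A B]) [:: B] D2.
  rewrite -catA; apply=> w /den_cat[x [y [-> /IH1 hx /den1 hy]]].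
  by apply/den1; exact: hy.
- by move=> A Pi B _ IH w hw x hx; apply: IH; exists x, w.
- move=> Pi A B D1 D2 C _ IH1 _ IH2 w hw; apply: IH2.
  move: w hw; apply: (@entails_ctx D1 (Rd B A :: Pi) [:: B] D2) => w [x [y [-> hx /IH1 hy]]].
  by apply/den1; exact: hx.
- move=> Pi A B _ IH w hw x hx; apply: IH; apply/den_cat.
  by exists w, x; split=> //; apply/den1.
- move=> D1 A B D2 C _ IH w hw; apply: IH; move: w hw.
  apply: (@entails_ctx D1 [:: _] [:: A; B] D2) => w /den1[x [y [-> hx hy]]].
  by exists x, y; split=> //; apply/den1.
- move=> Pi D A B _ IH1 _ IH2 w /den_cat[x [y [-> hx hy]]].
  by exists x, y; split; auto.
- move=> D1 D2 C _ IH w hw; apply: IH; move: w hw.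
  by apply: (@entails_ctx _ [:: One] [::]) => w /den1.
- move=> D1 A B D2 C _ _ IH w hw; apply: IH; move: w hw.
  by apply: (@entails_ctx _ [:: _] [:: _]) => w /den1[h _]; apply/den1.
- move=> D1 A B D2 C _ _ IH w hw; apply: IH; move: w hw.
  by apply: (@entails_ctx _ [:: _] [:: _]) => w /den1[_ h]; apply/den1.
- by move=> Pi A B _ IH1 _ IH2 w hw; split; auto.
- move=> D1 A B D2 C _ IH1 _ IH2 w /den_cat[x [y [-> hx [z [t [-> [hz|hz] ht]]]]]].
    by apply: IH1; apply/den_cat; exists x, (z ++ t); split=> //; exists z, t.
  by apply: IH2; apply/den_cat; exists x, (z ++ t); split=> //; exists z, t.
- by move=> Pi A B _ _ IH w hw; left; auto.
- by move=> Pi A B _ _ IH w hw; right; auto.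
- by move=> Pi B hb _ IH w hw; have w0 := den_bangs hb hw; subst w; auto.
- move=> D1 A D2 C _ IH w hw; apply: IH; move: w hw.
  by apply: (@entails_ctx _ [:: _] [:: _]) => w /den1[-> h]; apply/den1.
- by move=> D1 A Phi D2 C _ IH w; rewrite catA => /den_bang; rewrite -catA => /den_bang /IH.
- by move=> D1 A Phi D2 C _ IH w /den_bang; rewrite catA => /den_bang; rewrite -catA => /IH.
- by move=> D1 A D2 C _ IH w /den_bang[hA hw]; apply: IH; do 2!(apply/den_bang; split=> //).
- by move=> D1 A D2 C _ _ _ IH w /den_bang[_ /IH].
- move=> Pi A D1 D2 C _ _ IH1 _ IH2 w hw; apply: IH2; move: w hw.
  by apply: (@entails_ctx _ _ [:: _]) => w /IH1 h; apply/den1.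
Qed.

End Model.

(* Words are over the letters [0] (for the marker) and [r.+1] (for register [r]);
   a state denotes the set of queues from which the simulated machine halts. *)
Definition counts (w : seq nat) : nat -> nat := fun r => count_mem r.+1 w.

Definition val_at (M : cmachine) (p k : nat) (w : seq nat) : Prop :=
  let split (P : seq nat -> seq nat -> Prop) :=
    forall x y, w = x ++ 0 :: y -> 0 \notin x ++ y -> P x y in
  match k with
  | 0 => w = [:: p.+1]
  | 1 => 0 \notin w -> halts M (p, counts w)
  | 2 => split (fun x y =>
      if nth (INC 0) M p is DEC r j then
        if r.+1 \in x then
          halts M (p.+1, upd (counts (x ++ y)) r (counts (x ++ y) r).-1)
        else r.+1 \notin y -> halts M (j, counts (x ++ y))
      else True)
  | 3 => split (fun x y => halts M (p.+1, counts (x ++ y)))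
  | _ => if p == 0 then w = [:: 0] else True
  end.

Definition val (M : cmachine) (n : nat) : seq nat -> Prop :=
  val_at M (n %/ 5) (n %% 5).

Lemma val_code M p k : k < 5 -> val M (p * 5 + k) = val_at M p k.
Proof.
by move=> lt; rewrite /val modnMDl divnMDl // divn_small // modn_small // addn0.
Qed.

Lemma sem_ltr M r w : sem (val M) (ltr r) w <-> w = [:: r.+1].
Proof. by rewrite /= -[r * 5]addn0 val_code. Qed.

Lemma sem_hash M w : sem (val M) hash w <-> w = [:: 0].
Proof. by rewrite /= -[4]/(0 * 5 + 4) val_code. Qed.

(** The index 9 has residue 4 and quotient 1, where every word is accepted; this makes draining and
    collecting sound. *)
Lemma sem_fin M w : sem (val M) fin w.
Proof. by rewrite /= -[9]/(1 * 5 + 4) val_code. Qed.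

Lemma sem_st M p w :
  sem (val M) (st p) w <-> (0 \notin w -> halts M (p, counts w)).
Proof. by rewrite /= -addn1 val_code. Qed.

(** The marker separates the letters [x] still to be inspected from the letters [y] already rotated.
    The zero branch may assume [r] absent from [y], since [seek] rotates only other letters. *)
Lemma sem_seek M p r j w : nth (INC 0) M p = DEC r j ->
  sem (val M) (seek p) w <->
  (forall x y, w = x ++ 0 :: y -> 0 \notin x ++ y ->
     if r.+1 \in x then
       halts M (p.+1, upd (counts (x ++ y)) r (counts (x ++ y) r).-1)
     else r.+1 \notin y -> halts M (j, counts (x ++ y))).
Proof. by move=> e; rewrite /= -addn2 val_code //= e. Qed.

Lemma sem_wind M p w :
  sem (val M) (wind p) w <->
  (forall x y, w = x ++ 0 :: y -> 0 \notin x ++ y ->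
     halts M (p.+1, counts (x ++ y))).
Proof. by rewrite /= -addn3 val_code. Qed.

Lemma counts_perm w w' : perm_eq w w' -> counts w = counts w'.
Proof.
move=> h; apply: functional_extensionality => r.
exact: (permP h).
Qed.

Lemma counts_rcons w r : counts (w ++ [:: r.+1]) = upd (counts w) r (counts w r).+1.
Proof.
apply: functional_extensionality => s; rewrite updE /counts count_cat /= addn0 eqSS eq_sym.
by case: eqP => [->|_]; rewrite ?addn1 ?addn0.
Qed.

Lemma counts_cons w r : counts (r.+1 :: w) = upd (counts w) r (counts w r).+1.
Proof. by rewrite -counts_rcons; apply: counts_perm; rewrite -cat1s perm_catC. Qed.

Lemma halts_st_out M p R : size M <= p -> halts M (p, R).
Proof. by exists 0. Qed.

(** For a transition, containing the empty word means backward propagation: if the queue after it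
    lies in the language of the new state, the queue before it lies in that of the old one. *)
Lemma sem_rules M A : List.In A (rules M) -> sem (val M) A [::].
Proof.
move: A; apply: rules_ind.
- by move=> w _; rewrite cat0s; apply/sem_st => _; exact: halts_st_out.
- by move=> s _ x _ y _; exact: sem_fin.
- move=> p r lt e x h; rewrite cat0s; apply/sem_st => nx.
  have /h/sem_st hx : sem (val M) (ltr r) [:: r.+1] by exact/sem_ltr.
  have : halts M (p.+1, counts (x ++ [:: r.+1])).
    by apply: hx; rewrite mem_cat negb_or nx.
  have hs : reach M (p, counts x) (p.+1, counts (x ++ [:: r.+1])).
    by apply: reach_step; rewrite (step_INC _ lt e) counts_rcons.
  by move/(halts_reach hs).
move=> p r j lt e; split.
- move=> x h; rewrite cat0s; apply/sem_st => nx.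
  have /h/(sem_seek _ e) hx : sem (val M) hash [:: 0] by exact/sem_hash.
  have := hx x [::] erefl; rewrite cats0 => /(_ nx) {}hx.
  have hs : reach M (p, counts x) (if counts x r == 0 then (j, counts x)
      else (p.+1, upd (counts x) r (counts x r).-1)).
    by apply: reach_step; rewrite (step_DEC _ lt e).
  apply/(halts_reach hs).
  have -> : (counts x r == 0) = (r.+1 \notin x) by rewrite -has_pred1 has_count -eqn0Ngt.
  by move: hx; case: (r.+1 \in x) => //= hx; apply: hx.
- move=> _ /sem_hash -> x /sem_st h; rewrite cat0s; apply/(sem_seek _ e).
  (* The marker in front forces the part before it to be empty, so the zero branch is the one to
     prove. *)
  move=> [|a y] z /=; last first.
    by move=> [<- _]; rewrite inE.
  move=> [<-] nx _; have := h nx; case: (ltnP j (size M)) => [lj //|lj] _.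
  exact: halts_st_out.
- move=> _ /sem_ltr -> x /sem_wind h; rewrite cat0s; apply/(sem_seek _ e).
  move=> [//|a y] z [<- ex]; rewrite cat_cons !inE eqxx orTb => nx.
  by rewrite counts_cons updE eqxx upd_upd upd_id; exact: h.
- move=> _ /sem_hash -> x /sem_st h; rewrite cat0s; apply/sem_wind.
  move=> [|a y] z /=; last first.
    by move=> [<- _]; rewrite inE.
  by move=> [<-] nx; exact: h.
split=> s sM.
- move=> sr _ /sem_ltr -> x h; rewrite cat0s; apply/(sem_seek _ e).
  have /h/(sem_seek _ e) hx : sem (val M) (ltr s) [:: s.+1] by exact/sem_ltr.
  move=> [//|a y] z [<- ex]; rewrite cat_cons inE orFb => nx.
  have nx' : 0 \notin y ++ (z ++ [:: s.+1]).
    by rewrite catA mem_cat negb_or nx.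
  have ex' : x ++ [:: s.+1] = y ++ 0 :: (z ++ [:: s.+1]) by rewrite ex -catA.
  have cE : counts (s.+1 :: y ++ z) = counts (y ++ (z ++ [:: s.+1])).
    by apply: counts_perm; rewrite catA -[_ :: y ++ z]cat1s perm_catC.
  have := hx _ _ ex' nx'.
  rewrite cE inE eqSS (eq_sym r) (negbTE sr) orFb mem_cat inE eqSS (eq_sym r).
  by rewrite (negbTE sr) orbF.
- move=> _ /sem_ltr -> x h; rewrite cat0s; apply/sem_wind.
  have /h/sem_wind hx : sem (val M) (ltr s) [:: s.+1] by exact/sem_ltr.
  move=> [//|a y] z [<- ex]; rewrite cat_cons inE orFb => nx.
  have cE : counts (s.+1 :: y ++ z) = counts (y ++ (z ++ [:: s.+1])).
    by apply: counts_perm; rewrite catA -[_ :: y ++ z]cat1s perm_catC.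
  rewrite cE; apply: hx; first by rewrite ex -catA.
  by rewrite catA mem_cat negb_or nx.
Qed.

Lemma sem_collect M s w : sem (val M) (collect s) w.
Proof.
elim: s w => [|A s IH] w; first exact: sem_fin.
by move=> x _; exact: IH.
Qed.

Lemma E_simulation_sound b M n :
  Eder b (antecedent id M n) (st 0) -> halts M (init n).
Proof.
move=> /(E_sound (v := val M) (w := nseq n 1)) h.
have nn : 0 \notin nseq n 1 by rewrite mem_nseq andbF.
have -> : init n = (0, counts (nseq n 1)).
  congr (_, _); apply: functional_extensionality => r; rewrite /counts count_nseq /= eqSS.
  by rewrite eq_sym; case: r => [|r] //=; rewrite mul1n.
apply: (proj1 (sem_st M 0 _) _ nn); apply: h => {nn}.
have hp A : List.In A (program id M) -> sem (val M) A [::].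
  by rewrite /program map_id => -[<-|/sem_rules //]; exact: sem_collect.
rewrite /antecedent; apply/den_cat; exists (nseq n 1), [::]; split; rewrite ?cats0 //.
  elim: n => //= n IH; exists [:: 1], (nseq n 1); split=> //; exact/(sem_ltr M 0).
elim: (program _ _) hp => //= A l IH hp; exists [::], [::]; split=> //.
  by split=> //; apply: hp; left.
by apply: IH => B hB; apply: hp; right.
Qed.

(** * Completeness: simulating a run *)

Lemma mem_split_first (T : eqType) (x : T) s : x \in s ->
  exists s1 s2, s = s1 ++ x :: s2 /\ x \notin s1.
Proof.
elim: s => //= y s IH; rewrite inE; case: eqVneq => [-> _|ne /= /IH].
  by exists [::], s.
by move=> [s1 [s2 [-> n1]]]; exists (y :: s1), s2; rewrite inE negb_or ne.
Qed.

Lemma regs_instr M p : p < size M -> reg_of (nth (INC 0) M p) \in regs M.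
Proof.
move=> lt; rewrite inE; apply/orP; right.
by rewrite -(nth_map _ 0) // mem_nth ?size_map.
Qed.

(** [D G q] abstracts derivability of [q] from the queue [G] in the presence of the banged program;
    the hypotheses are all that the simulation asks of a calculus. *)
Section Simulation.
Variables (M : cmachine) (D : seq fm -> fm -> Prop).
Hypothesis D_pop : forall n b q G,
  List.In (pop (V n) b q) (rules M) -> D G b -> D (V n :: G) q.
Hypothesis D_goto : forall b q G, List.In (Rd q b) (rules M) -> D G b -> D G q.
Hypothesis D_right : forall b x G, D (G ++ [:: x]) b -> D G (Rd b x).
Hypothesis D_fin : D [::] fin.

Lemma D_drain w : all (mem (regs M)) w -> D (map ltr w) fin.
Proof.
elim: w => //= r w IH /andP[hr /IH hw]; apply: D_pop hw.
apply/in_catP; right; apply/in_catP; left; apply/in_mapP.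
by exists r; split=> //; apply/in_memP.
Qed.

Section Dec.
Variables p r j : nat.
Hypothesis lt_p : p < size M.
Hypothesis instr_p : nth (INC 0) M p = DEC r j.

(** Read upwards, each step moves the head of [u] behind [v]; when the marker reaches the front it
    is deleted, and [v ++ u] remains. *)
Lemma D_wind u v : all (mem (regs M)) u ->
  D (map ltr (v ++ u)) (st p.+1) -> D (map ltr u ++ hash :: map ltr v) (wind p).
Proof.
elim: u v => [|s u IH] v /=.
  rewrite cats0 => _; apply: D_pop; apply: (rules_instr lt_p); rewrite instr_p.
  by apply/in_catP; left; do 3!right; left.
move=> /andP[hs hu] h; apply: (D_pop (b := Rd (wind p) (ltr s))).
  apply: (rules_instr lt_p); rewrite instr_p; apply/in_catP; right.
  by apply/in_catP; right; apply/in_mapP; exists s; split=> //; apply/in_memP.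
apply: D_right; rewrite -catA cat_cons -(map_cat ltr v [:: s]).
by apply: IH => //; rewrite -catA.
Qed.

Lemma D_seek_rot u v s : s \in regs M -> s != r ->
  D (map ltr u ++ hash :: map ltr (v ++ [:: s])) (seek p) ->
  D (map ltr (s :: u) ++ hash :: map ltr v) (seek p).
Proof.
move=> hs sr h; apply: (D_pop (b := Rd (seek p) (ltr s))).
  apply: (rules_instr lt_p); rewrite instr_p; apply/in_catP; right.
  apply/in_catP; left; apply/in_mapP; exists s; split=> //; apply/in_memP.
  by rewrite mem_filter sr.
by apply: D_right; rewrite -catA cat_cons -(map_cat ltr v [:: s]).
Qed.

Lemma D_seek_zero u v : all (mem (regs M)) u -> r \notin u ->
  D (map ltr (v ++ u)) (st (minn j (size M))) ->
  D (map ltr u ++ hash :: map ltr v) (seek p).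
Proof.
elim: u v => [|s u IH] v.
  rewrite cats0 => _ _; apply: D_pop; apply: (rules_instr lt_p); rewrite instr_p.
  by apply/in_catP; left; right; left.
move=> /= /andP[hs hu]; rewrite inE negb_or eq_sym => /andP[sr ru] h.
by apply: D_seek_rot => //; apply: IH => //; rewrite -catA.
Qed.

Lemma D_seek_pos u1 u2 v : all (mem (regs M)) (u1 ++ u2) -> r \notin u1 ->
  D (map ltr (v ++ u1 ++ u2)) (st p.+1) ->
  D (map ltr (u1 ++ r :: u2) ++ hash :: map ltr v) (seek p).
Proof.
elim: u1 v => [|s u1 IH] v.
  move=> hu _ h; apply: (D_pop (b := wind p)); last exact: D_wind.
  apply: (rules_instr lt_p); rewrite instr_p.
  by apply/in_catP; left; do 2!right; left.
move=> /= /andP[hs hu]; rewrite inE negb_or eq_sym => /andP[sr ru] h.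
by apply: D_seek_rot => //; apply: IH => //; rewrite -catA.
Qed.

End Dec.

Lemma simulation k p w : p <= size M -> all (mem (regs M)) w ->
  size M <= (run M k (p, fun r => count_mem r w)).1 -> D (map ltr w) (st p).
Proof.
elim: k p w => [|k IH] p w le hw.
  rewrite /run /= => ge; have -> : p = size M by lia.
  by apply: (D_goto (b := fin)); [apply/in_catP; left; left | exact: D_drain].
rewrite /run iterSr -/(run M k _); case: (ltnP p (size M)) => [lt|ge]; last first.
  rewrite step_out // => _; have -> : p = size M by lia.
  by apply: (D_goto (b := fin)); [apply/in_catP; left; left | exact: D_drain].
have hr := regs_instr lt.
case e: (nth (INC 0) M p) hr => [r|r j] hr.
  rewrite (step_INC _ lt e) => h.
  apply: (D_goto (b := Rd (st p.+1) (ltr r))).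
    by apply: (rules_instr lt); rewrite e; left.
  apply: D_right; rewrite -(map_cat ltr w [:: r]); apply: IH => //.
    by rewrite all_cat hw /= andbT.
  move: h; congr (_ <= (run M k (_, _)).1).
  apply: functional_extensionality => s; rewrite updE count_cat /= addn0 [r == s]eq_sym.
  by case: eqP => [->|_]; rewrite ?addn1 ?addn0.
rewrite (step_DEC _ lt e) => h.
apply: (D_goto (b := Rd (seek p) hash)).
  by apply: (rules_instr lt); rewrite e; apply/in_catP; left; left.
apply: D_right; rewrite -[[:: hash]]/(hash :: map ltr [::]).
case: (boolP (r \in w)) => rw.
  have [u1 [u2 [ew ru]]] := mem_split_first rw.
  have hu : all (mem (regs M)) (u1 ++ u2).
    by move: hw; rewrite ew !all_cat /= => /and3P[-> _ ->].
  rewrite ew; apply: (D_seek_pos lt e) => //; rewrite cat0s; apply: IH => //.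
  move: h; rewrite eqn0Ngt -has_count has_pred1 rw /=; congr (_ <= (run M k (_, _)).1).
  apply: functional_extensionality => s; rewrite updE ew !count_cat /=.
  by case: (eqVneq s r) => [->|]; rewrite ?eqxx ?[r == s]eq_sym; lia.
apply: (D_seek_zero lt e) => //; rewrite cat0s; apply: IH => //; first lia.
(* If the jump leads beyond the end, the clamped configuration has halted too, which is all that the
   induction hypothesis asks. *)
move: h; rewrite (count_memPn rw) /=; case: (leqP j (size M)) => [lj|lj]; first by [].
by rewrite !run_out /= ?leqnn // ltnW.
Qed.

Lemma simulation_init n : halts M (init n) -> D (nseq n (ltr 0)) (st 0).
Proof.
move=> [k hk]; have <- : map ltr (nseq n 0) = nseq n (ltr 0) by rewrite map_nseq.
  apply: (@simulation k) => //.
  by rewrite all_nseq /= orbT.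
move: hk; congr (_ <= (run M k (_, _)).1).
apply: functional_extensionality => r; rewrite count_nseq /= eq_sym.
by case: eqP; rewrite ?mul1n ?mul0n.
Qed.

End Simulation.

(** ** The calculus E *)

Lemma map_Bang_bangs s X : List.In X (map Bang s) -> is_bang X.
Proof. by move=> /in_mapP[B [<- _]]; exists B. Qed.

Lemma E_bangs_right b D1 s Phi D2 C :
  Eder b (D1 ++ map Bang s ++ Phi ++ D2) C -> Eder b (D1 ++ Phi ++ map Bang s ++ D2) C.
Proof.
elim: s D1 => //= A s IH D1 h; apply: E_BangP1.
by rewrite -cat1s catA; apply: IH; rewrite -catA.
Qed.

Lemma E_bangs_left b D1 s Phi D2 C :
  Eder b (D1 ++ Phi ++ map Bang s ++ D2) C -> Eder b (D1 ++ map Bang s ++ Phi ++ D2) C.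
Proof.
elim: s D1 => //= A s IH D1 /E_BangP2.
by rewrite -cat1s catA => /IH; rewrite -catA.
Qed.

Lemma E_bangs_dereliction b D1 s D2 C :
  Eder b (D1 ++ s ++ D2) C -> Eder b (D1 ++ map Bang s ++ D2) C.
Proof.
elim: s D1 => //= A s IH D1 h; apply: E_BangL.
by rewrite -cat1s catA; apply: IH; rewrite -catA.
Qed.

Lemma E_collect b s : (forall A, List.In A s -> nobr A) -> Eder b (collect s :: s) fin.
Proof.
elim: s => [|A s IH] h; first exact: E_ax.
have := @E_RdL b [:: A] A (collect s) [::] s fin; apply.
  by apply: E_ax; apply: h; left.
by apply: IH => B hB; apply: h; right.
Qed.

Lemma E_simulation_complete b M n :
  halts M (init n) -> Eder b (antecedent id M n) (st 0).
Proof.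
set Bs := map Bang (program id M).
have hA A : List.In A (rules M) -> nobr A.
  move=> h; apply: nobr_frag; apply: (@frag_nobr_program M).
  by rewrite /program map_id; right.
(* Contraction supplies a second copy of the banged transition, permutation takes it to the front,
   and dereliction opens it. *)
have use A G q : List.In A (rules M) -> Eder b (A :: G ++ Bs) q -> Eder b (G ++ Bs) q.
  move=> hin; have hB : List.In (Bang A) Bs.
    by apply/in_mapP; exists A; rewrite /program map_id; split=> //; right.
  have [b1 [b2 ->]] := List.in_split _ _ hB => h; rewrite catA; apply: E_BangC.
  have := @E_BangP1 b [::] A (G ++ b1) (Bang A :: b2) q; apply.
  by have := @E_BangL b [::] A; apply; rewrite -!catA.
apply: (simulation_init (D := fun G q => Eder b (G ++ Bs) q)).
- move=> x c q G hin h; apply: (use _ _ _ hin).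
  have := @E_RdL b [:: V x] (V x) (Rd q c) [::] (G ++ Bs) q; apply; first exact: E_ax.
  have := @E_RdL b (G ++ Bs) c q [::] [::] q; rewrite cats0; apply=> //.
  by apply: E_ax; case: (hA _ hin) => -[].
- move=> c q G hin h; apply: (use _ _ _ hin).
  have := @E_RdL b (G ++ Bs) c q [::] [::] q; rewrite cats0; apply=> //.
  by apply: E_ax; case: (hA _ hin).
(* The letter enters to the right of the banged formulae and is moved across them to the end of the
   queue. *)
- move=> c x G h; apply: E_RdR; rewrite -catA.
  have := @E_bangs_left b G (program id M) [:: x] [::] c; rewrite !cats0.
  by rewrite -/Bs catA; apply.
(* In place of weakening, every banged formula is opened once and [collect] absorbs the
   transitions. *)
have := @E_bangs_dereliction b [::] (program id M) [::] fin; rewrite !cats0; apply.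
by rewrite /program; apply: E_collect => A; rewrite map_id; exact: hA.
Qed.

(** ** The calculus F *)

Lemma F_collect s : Fder (map FF (collect s :: s)) fin.
Proof.
elim: s => [|A s IH]; first exact: F_ax.
have := @F_RdL [:: FF A] A FHole [::] (collect s) (map FF s) fin; apply=> //.
exact: F_ax.
Qed.

Lemma F_bangs_left D1 s Phi D2 C :
  Fder (D1 ++ Phi ++ map FF (map Bang s) ++ D2) C ->
  Fder (D1 ++ map FF (map Bang s) ++ Phi ++ D2) C.
Proof.
elim: s D1 => //= A s IH D1 /(@F_BangP2 FHole) /=.
by rewrite -cat1s catA => /IH; rewrite -catA.
Qed.

Lemma F_bangs_dereliction D1 s D2 C :
  Fder (D1 ++ map FF s ++ D2) C -> Fder (D1 ++ map FF (map Bang s) ++ D2) C.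
Proof.
elim: s D1 => //= A s IH D1 h; apply: (@F_BangL FHole) => /=.
by rewrite -cat1s catA; apply: IH; rewrite -catA.
Qed.

(* Contraction creates a bracket, which the modality [Box] removes. *)
Lemma F_use A G Phi C : List.In (Bang (Box A)) Phi ->
  Fder (FF A :: map FF (G ++ Phi)) C -> Fder (map FF (G ++ Phi)) C.
Proof.
move=> hin; have [b1 [b2 ->]] := List.in_split _ _ hin; rewrite catA map_cat /= => h.
set L := map FF (G ++ b1) in h *; set R := map FF b2 in h *.
apply: (@F_BangP1 FHole [::] (Box A) L R) => /=.
(* Contraction is applied with empty [G1] and [G2], so the new bracket contains just the copy. *)
apply: (@F_BangC FHole [:: FF (Bang (Box A))] [::] [::]) => //=.
  by move=> t [<-|//]; exists (Box A).
apply: (@F_BangL (FBr [:: FF (Bang (Box A))] FHole (L ++ R)) [::] (Box A) [::]) => /=.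
apply: (@F_BoxL FHole [:: FF (Bang (Box A))]) => /=.
exact: (@F_BangP2 FHole [::] (Box A) (FF A :: L) R).
Qed.

Lemma F_simulation_complete M n :
  halts M (init n) -> Fder (map FF (antecedent Box M n)) (st 0).
Proof.
set Bs := map Bang (program Box M).
have use A G q : List.In A (rules M) ->
    Fder (FF A :: map FF (G ++ Bs)) q -> Fder (map FF (G ++ Bs)) q.
  move=> h; apply: F_use; apply/in_mapP; exists (Box A); split=> //.
  by right; apply/in_mapP; exists A.
apply: (simulation_init (D := fun G q => Fder (map FF (G ++ Bs)) q)).
- move=> x c q G hin h; apply: (use _ _ _ hin).
  have := @F_RdL [:: FF (V x)] (V x) FHole [::] (Rd q c) (map FF (G ++ Bs)) q.
  apply; first exact: F_ax.
  have := @F_RdL (map FF (G ++ Bs)) c FHole [::] q [::] q.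
  by rewrite cats0; apply=> //; exact: F_ax.
- move=> c q G hin h; apply: (use _ _ _ hin).
  have := @F_RdL (map FF (G ++ Bs)) c FHole [::] q [::] q.
  by rewrite cats0; apply=> //; exact: F_ax.
- move=> c x G h; apply: F_RdR; rewrite map_cat -catA.
  have := @F_bangs_left (map FF G) (program Box M) [:: FF x] [::] c; rewrite !cats0.
  by apply; move: h; rewrite -catA !map_cat.
have := @F_bangs_dereliction [::] (program Box M) [::] fin; rewrite !cats0; apply.
exact: F_collect.
Qed.

(** ** The calculi M *)

Lemma M_derelictions b z G s D2 C :
  Mder b (z, G ++ map TF s ++ D2) C -> Mder b (z ++ s, G ++ D2) C.
Proof.
elim: s z G => [|A s IH] z G /=; first by rewrite cats0.
rewrite -cat1s catA => /IH h.
apply: (@M_perm b MHole ((z ++ s) ++ [:: A])).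
  rewrite -catA; apply: Permutation_app_head.
  by apply: Permutation_sym; exact: Permutation_cons_append.
by apply: (@M_BangP b MHole); rewrite -catA in h.
Qed.

Lemma M_bangs b z G s C :
  Mder b (z ++ s, G) C -> Mder b (z, G ++ map TF (map Bang s)) C.
Proof.
elim: s z G => [|A s IH] z G /=; first by rewrite !cats0.
move=> h; apply: (@M_BangL b MHole) => /=; apply: IH.
by rewrite -catA.
Qed.

Lemma M_collect b s : Mder b ([::], map TF (collect s :: s)) fin.
Proof.
elim: s => [|A s IH]; first exact: M_ax.
apply: (@M_RdL b [::] [:: TF A] A MHole [::] [::] (collect s) (map TF s)) IH.
exact: M_ax.
Qed.

(** Read upwards, contraction opens a bracket whose stoup is a copy of [Box A]; [M_BangP] moves the
    copy into its content, and [M_BoxL] dissolves the bracket, leaving [A] in front. *)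
Lemma M_use b A z G C : List.In (Box A) z ->
  Mder b (z, TF A :: G) C -> Mder b (z, G) C.
Proof.
move=> hin h0; have [l1 [l2 e]] := List.in_split _ _ hin; move: h0.
(* Contraction is applied to the last formula of the stoup, hence the reordering [y]; in the primed
   calculus [z'] is taken empty. *)
rewrite e => h; set y := (l1 ++ l2) ++ [:: Box A].
have py : Permutation (l1 ++ Box A :: l2) y.
  by rewrite /y -catA; apply: Permutation_app_head; exact: Permutation_cons_append.
apply: (@M_perm b MHole y); first exact: Permutation_sym.
have {h} : Mder b (y, TF A :: G) C by exact: (@M_perm b MHole _ _ _ _ py).
move=> /(@M_BoxL b MHole y [::]) /=.
move=> /(@M_BangP b (MBr y [::] MHole G) [::] [::] (Box A) [::]) /= h.
case: b h => h.
  by have := @M_BangC' true MHole (l1 ++ l2) [:: Box A] [::] [::] [::] G C; apply.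
exact: (@M_BangC false MHole (l1 ++ l2) [:: Box A] [::] [::] G C).
Qed.

Lemma M_simulation_complete b M n :
  halts M (init n) -> Mder b ([::], map TF (antecedent Box M n)) (st 0).
Proof.
(* The banged program moves into the stoup at the outset, so [D] deals with the queue alone. *)
move=> hM; rewrite map_cat; apply: M_bangs; rewrite cat0s; move: hM.
set z := program Box M.
have use A G q : List.In A (rules M) -> Mder b (z, TF A :: G) q -> Mder b (z, G) q.
  by move=> h; apply: M_use; right; apply/in_mapP; exists A.
apply: (simulation_init (D := fun G q => Mder b (z, map TF G) q)).
- move=> x c q G hin h; apply: (use _ _ _ hin).
  apply: (@M_RdL b [::] [:: TF (V x)] (V x) MHole z [::] (Rd q c) (map TF G)).
    exact: M_ax.
  (* The whole stoup goes to the premise for [c], as the other premise is an axiom with empty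
     stoup. *)
  have := @M_RdL b z (map TF G) c MHole [::] [::] q [::] q.
  by rewrite !cats0; apply=> //; exact: M_ax.
- move=> c q G hin h; apply: (use _ _ _ hin).
  have := @M_RdL b z (map TF G) c MHole [::] [::] q [::] q.
  by rewrite !cats0; apply=> //; exact: M_ax.
- by move=> c x G h; apply: M_RdR; move: h; rewrite map_cat.
have := @M_derelictions b [::] [::] z [::] fin; apply; rewrite cats0.
exact: M_collect.
Qed.

(** * Erasing brackets *)

Lemma E_bangs_contract b D1 s Phi D2 C :
  Eder b (D1 ++ map Bang s ++ Phi ++ map Bang s ++ D2) C ->
  Eder b (D1 ++ map Bang s ++ Phi ++ D2) C.
Proof.
move=> h0; have := @E_bangs_left b (D1 ++ map Bang s) s Phi D2 C.
rewrite -!catA => /(_ h0) {h0}; elim: s D1 => //= A s IH D1 h; apply: E_BangC.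
rewrite -[_ :: _ :: _]/([:: Bang A; Bang A] ++ _) catA; apply: IH.
have := @E_BangP2 b (D1 ++ [:: Bang A]) A (map Bang s) (map Bang s ++ Phi ++ D2) C.
by rewrite -!catA; apply.
Qed.

Fixpoint erase (A : fm) : fm :=
  match A with
  | V n => V n
  | One => One
  | Ld A B => Ld (erase A) (erase B)
  | Rd B A => Rd (erase B) (erase A)
  | Mul A B => Mul (erase A) (erase B)
  | And A B => And (erase A) (erase B)
  | Or A B => Or (erase A) (erase B)
  | Dia A | Box A => erase A
  | Bang A => Bang (erase A)
  end.

Lemma nobr_erase A : nobr (erase A).
Proof. by elim: A => /=. Qed.

Lemma erase_id A : nobr A -> erase A = A.
Proof.
elim: A => //= [A IHA B IHB|A IHA B IHB|A IHA B IHB|A IHA B IHB|A IHA B IHB|A IHA].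
1-5: by move=> [/IHA -> /IHB ->].
by move=> /IHA ->.
Qed.

Fixpoint flat_ftm (t : ftm) : seq fm :=
  match t with
  | FF A => [:: erase A]
  | FB g => flatten (map flat_ftm g)
  end.

Definition flat (g : seq ftm) : seq fm := flatten (map flat_ftm g).

Lemma flat_cat g h : flat (g ++ h) = flat g ++ flat h.
Proof. by rewrite /flat map_cat flatten_cat. Qed.

Lemma flat_FF A g : flat (FF A :: g) = erase A :: flat g.
Proof. by []. Qed.

Lemma flat_FB g h : flat (FB g :: h) = flat g ++ flat h.
Proof. by []. Qed.

Lemma flat_nil : flat [::] = [::].
Proof. by []. Qed.

Definition flatE := (flat_cat, flat_FF, flat_FB, flat_nil, cat0s, cats0).

(** Once brackets are erased, the depth of an occurrence is invisible: a context becomes a left and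
    a right part that do not depend on what is plugged in. *)
Lemma flat_fplug X D1 D2 :
  exists L R, forall g, flat (fplug X (D1 ++ g ++ D2)) = L ++ flat g ++ R.
Proof.
elim: X => [|l X [L [R h]] r]; first by exists (flat D1), (flat D2) => g; rewrite /= !flat_cat.
by exists (flat l ++ L), (R ++ flat r) => g; rewrite /= !flatE h -!catA.
Qed.

Lemma flat_step b X D1 D2 g h C :
  (forall L R, Eder b (L ++ flat g ++ R) C -> Eder b (L ++ flat h ++ R) C) ->
  Eder b (flat (fplug X (D1 ++ g ++ D2))) C ->
  Eder b (flat (fplug X (D1 ++ h ++ D2))) C.
Proof. by move=> H; have [L [R e]] := flat_fplug X D1 D2; rewrite !e; exact: H. Qed.

Lemma flat_bangs g : (forall t, List.In t g -> is_bang_tm t) ->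
  exists s, flat g = map Bang s.
Proof.
elim: g => [|t g IH] h; first by exists [::].
have [A ->] := h _ (or_introl erefl).
have [|s es] := IH; first by move=> u hu; apply: h; right.
by exists (erase A :: s); rewrite flat_FF es.
Qed.

(** The bracket rules become trivial, and contraction becomes contraction of a block of banged
    formulae across [G1]. No rule is translated with weakening, so [b] is arbitrary. *)
Lemma F_erase b G C : Fder G C -> Eder b (flat G) (erase C).
Proof.
elim=> {G C}.
- by move=> A; apply: E_ax; exact: nobr_erase.
- exact: E_one.
- move=> Ga B X D1 C D2 D _ IH1 _; rewrite -cat_cons.
  apply: (@flat_step b X D1 D2 [:: FF C]) => L R IH2; rewrite !flatE.
  exact: E_RdL IH1 IH2.
- by move=> Ga B C _; rewrite !flatE => IH; exact: E_RdR.
- move=> Ga A X D1 C D2 D _ IH1 _.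
  have := @flat_step b X D1 D2 [:: FF C] (Ga ++ [:: FF (Ld A C)]) (erase D).
  rewrite -catA; apply=> L R IH2; rewrite !flatE -catA.
  exact: E_LdL IH1 IH2.
- by move=> A Ga C _; exact: E_LdR.
- move=> X D1 A B D2 D _.
  apply: (@flat_step b X D1 D2 [:: FF A; FF B] [:: FF (Mul A B)]) => L R; exact: E_MulL.
- by move=> De A Ga B _ IH1 _ IH2; rewrite flat_cat; exact: E_MulR.
- move=> X D1 D2 A _.
  apply: (@flat_step b X D1 D2 [::] [:: FF One]) => L R; exact: E_OneL.
- move=> X D1 A B D2 C _.
  apply: (@flat_step b X D1 D2 [:: FF A] [:: FF (And A B)]) => L R.
  by apply: E_AndL1; exact: nobr_erase.
- move=> X D1 A B D2 C _.
  apply: (@flat_step b X D1 D2 [:: FF B] [:: FF (And A B)]) => L R.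
  by apply: E_AndL2; exact: nobr_erase.
- by move=> Xi A B _ IH1 _ IH2; exact: E_AndR.
- move=> X D1 A B D2 C _ + _; have [L [R e]] := flat_fplug X D1 D2.
  have /= eA := e [:: FF A]; have /= eB := e [:: FF B]; have /= eO := e [:: FF (Or A B)].
  by rewrite eA eB eO; exact: E_OrL.
- by move=> Xi A B _; apply: E_OrR1; exact: nobr_erase.
- by move=> Xi A B _; apply: E_OrR2; exact: nobr_erase.
- move=> X D1 A D2 B _.
  by apply: (@flat_step b X D1 D2 [:: FF A] [:: FB [:: FF (Box A)]]).
- by move=> Xi A _; rewrite !flatE.
- move=> X D1 A D2 B _.
  by apply: (@flat_step b X D1 D2 [:: FB [:: FF A]] [:: FF (Dia A)]).
- by move=> Xi A _; rewrite !flatE.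
- move=> X D1 A D2 C _.
  apply: (@flat_step b X D1 D2 [:: FF A] [:: FF (Bang A)]) => L R; exact: E_BangL.
- move=> X D1 A Phi D2 C _.
  have := @flat_step b X D1 D2 (FF (Bang A) :: Phi) (Phi ++ [:: FF (Bang A)]) (erase C).
  rewrite -!catA; apply=> L R; rewrite !flatE -!catA; exact: E_BangP1.
- move=> X D1 A Phi D2 C _.
  have := @flat_step b X D1 D2 (Phi ++ [:: FF (Bang A)]) (FF (Bang A) :: Phi) (erase C).
  rewrite -!catA; apply=> L R; rewrite !flatE -!catA; exact: E_BangP2.
- move=> Pi B _ /flat_bangs[s es] _; rewrite es; apply: E_BangR => X.
  exact: map_Bang_bangs.
- move=> X Bs G1 G2 G3 C _ /flat_bangs[s es] _.
  have := @flat_step b X [::] G3 (Bs ++ G1 ++ [:: FB (Bs ++ G2)]) (Bs ++ G1 ++ G2) (erase C).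
  rewrite /= -!catA; apply=> L R.
  rewrite !flatE es -!catA; exact: E_bangs_contract.
- move=> Pi A X G1 G2 C _ IH1 _.
  apply: (@flat_step b X G1 G2 [:: FF A]) => L R.
  by apply: E_cut IH1; exact: nobr_erase.
Qed.

(** A formula in a stoup stands for its banged version, so a stoup is flattened to banged formulae
    in front of its sequence. *)
Fixpoint flat_tm (t : tm) : seq fm :=
  match t with
  | TF A => [:: erase A]
  | TB z g => map Bang (map erase z) ++ flatten (map flat_tm g)
  end.

Definition flats (g : seq tm) : seq fm := flatten (map flat_tm g).

Definition flat_stoup (z : seq fm) : seq fm := map Bang (map erase z).

Definition flat_meta (m : meta) : seq fm := flat_stoup m.1 ++ flats m.2.

Lemma flats_cat g h : flats (g ++ h) = flats g ++ flats h.
Proof. by rewrite /flats map_cat flatten_cat. Qed.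

Lemma flats_TF A g : flats (TF A :: g) = erase A :: flats g.
Proof. by []. Qed.

Lemma flats_TB z g h : flats (TB z g :: h) = flat_stoup z ++ flats g ++ flats h.
Proof. by rewrite [LHS]/= catA. Qed.

Lemma flats_nil : flats [::] = [::].
Proof. by []. Qed.

Lemma flat_stoup_cat z y : flat_stoup (z ++ y) = flat_stoup z ++ flat_stoup y.
Proof. by rewrite /flat_stoup !map_cat. Qed.

Definition flatsE :=
  (flats_cat, flats_TF, flats_TB, flats_nil, flat_stoup_cat, cat0s, cats0).

Lemma flat_mplug X : exists L R, forall m, flat_meta (mplug X m) = L ++ flat_meta m ++ R.
Proof.
elim: X => [|z l X [L [R h]] r]; first by exists [::], [::] => m; rewrite cats0.
exists (flat_stoup z ++ flats l ++ L), (R ++ flats r) => m.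
rewrite /= {1}/flat_meta /= !flatsE -!catA.
have := h m; rewrite {1}/flat_meta => /(congr1 (cat^~ (flats r))).
by rewrite -!catA => ->.
Qed.

Lemma flat_mstep b X D1 D2 z y g h C :
  (forall L R, Eder b (L ++ flat_stoup z ++ flats D1 ++ flats g ++ R) C ->
     Eder b (L ++ flat_stoup y ++ flats D1 ++ flats h ++ R) C) ->
  Eder b (flat_meta (mplug X (z, D1 ++ g ++ D2))) C ->
  Eder b (flat_meta (mplug X (y, D1 ++ h ++ D2))) C.
Proof.
move=> H; have [L [R e]] := flat_mplug X.
by rewrite !e /flat_meta /= !flats_cat -!catA; exact: H.
Qed.

Lemma flat_mstep0 b X D1 D2 z g h C :
  (forall L R, Eder b (L ++ flats g ++ R) C -> Eder b (L ++ flats h ++ R) C) ->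
  Eder b (flat_meta (mplug X (z, D1 ++ g ++ D2))) C ->
  Eder b (flat_meta (mplug X (z, D1 ++ h ++ D2))) C.
Proof.
move=> H; apply: flat_mstep => L R.
by have := H (L ++ flat_stoup z ++ flats D1) R; rewrite -!catA.
Qed.

Lemma E_stoup_perm b L z y R C : Permutation z y ->
  Eder b (L ++ flat_stoup z ++ R) C -> Eder b (L ++ flat_stoup y ++ R) C.
Proof.
move=> h; elim: h L => {z y} [|A z y _ IH|A B z|x y z _ IH1 _ IH2] L //=.
- by rewrite -cat1s catA => /IH; rewrite -catA.
- exact: (@E_BangP1 b L (erase B) [:: Bang (erase A)]).
- by move=> /IH1/IH2.
Qed.

Lemma M_erase b p Xi C : Mder p Xi C -> Eder b (flat_meta Xi) (erase C).
Proof.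
elim=> {Xi C}.
- move=> X z z' G C hz _; have [L [R e]] := flat_mplug X.
  by rewrite !e /flat_meta -!catA; exact: E_stoup_perm.
- by move=> A; apply: E_ax; exact: nobr_erase.
- exact: E_one.
- move=> z1 Ga B X z2 D1 C D2 D _ IH1 _; rewrite -cat_cons.
  apply: (@flat_mstep b X D1 D2 _ _ [:: TF C]) => L R IH2; rewrite !flatsE -!catA.
  (* The stoup of the left premise arises next to [Ga] and is permuted to the front. *)
  have := @E_bangs_left b L (map erase z1)
    (flat_stoup z2 ++ flats D1 ++ [:: Rd (erase C) (erase B)]) (flats Ga ++ R) (erase D).
  rewrite -!catA; apply.
  have := @E_RdL b _ _ (erase C) (L ++ flat_stoup z2 ++ flats D1) R (erase D) IH1.
  by rewrite /flat_meta -!catA; apply.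
- by move=> z Ga B C _; rewrite /flat_meta !flatsE catA => IH; exact: E_RdR.
- move=> z1 Ga A X z2 D1 C D2 D _ IH1 _.
  have := @flat_mstep b X D1 D2 z2 (z1 ++ z2) [:: TF C] (Ga ++ [:: TF (Ld A C)]) (erase D).
  rewrite -!catA; apply=> L R IH2; rewrite !flatsE -!catA.
  have := @E_bangs_left b L (map erase z1)
    (flat_stoup z2 ++ flats D1) (flats Ga ++ Ld (erase A) (erase C) :: R) (erase D).
  rewrite -!catA; apply.
  have := @E_LdL b _ _ (erase C) (L ++ flat_stoup z2 ++ flats D1) R (erase D) IH1.
  by rewrite /flat_meta -!catA; apply.
- move=> z A Ga C _ IH; apply: E_LdR.
  by have := @E_bangs_right b [::] (map erase z) [:: erase A] (flats Ga); apply.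
- move=> X z D1 A B D2 D _.
  apply: (@flat_mstep0 b X D1 D2 z [:: TF A; TF B] [:: TF (Mul A B)]) => L R.
  exact: E_MulL.
- move=> z1 De A z2 Ga B _ IH1 _ IH2; rewrite /flat_meta !flatsE -catA.
  apply: E_bangs_left; rewrite catA; exact: E_MulR IH1 IH2.
- move=> X z D1 D2 A _.
  apply: (@flat_mstep0 b X D1 D2 z [::] [:: TF One]) => L R; exact: E_OneL.
- move=> X z D1 A B D2 C _.
  apply: (@flat_mstep0 b X D1 D2 z [:: TF A] [:: TF (And A B)]) => L R.
  by apply: E_AndL1; exact: nobr_erase.
- move=> X z D1 A B D2 C _.
  apply: (@flat_mstep0 b X D1 D2 z [:: TF B] [:: TF (And A B)]) => L R.
  by apply: E_AndL2; exact: nobr_erase.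
- by move=> Xi A B _ IH1 _ IH2; exact: E_AndR.
- move=> X z D1 A B D2 C _ + _; have [L [R e]] := flat_mplug X.
  rewrite !e /flat_meta !flatsE -!catA /=.
  rewrite !(catA (flat_stoup z)) !(catA L); exact: E_OrL.
- by move=> Xi A B _; apply: E_OrR1; exact: nobr_erase.
- by move=> Xi A B _; apply: E_OrR2; exact: nobr_erase.
- move=> X z D1 A D2 B _.
  by apply: (@flat_mstep0 b X D1 D2 z [:: TF A] [:: TB [::] [:: TF (Box A)]]).
- by move=> z Ga A _; rewrite /flat_meta !flatsE.
- move=> X z D1 A D2 B _.
  by apply: (@flat_mstep0 b X D1 D2 z [:: TB [::] [:: TF A]] [:: TF (Dia A)]).
- by move=> z Ga A _; rewrite /flat_meta !flatsE.
- move=> X z A G1 G2 B _.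
  apply: (@flat_mstep b X G1 G2 _ _ [::] [:: TF (Bang A)]) => L R.
  rewrite !flatsE -!catA => IH.
  have := @E_BangP1 b (L ++ flat_stoup z) (erase A) (flats G1) R (erase B).
  by rewrite -!catA; apply.
- move=> X z G1 A G2 B _.
  apply: (@flat_mstep b X G1 G2 _ _ [:: TF A] [::]) => L R.
  rewrite !flatsE -!catA => IH.
  have := @E_BangP2 b (L ++ flat_stoup z) (erase A) (flats G1) R (erase B).
  rewrite -!catA; apply.
  have := @E_BangL b (L ++ flat_stoup z ++ flats G1) (erase A) R (erase B).
  by rewrite -!catA; apply.
- move=> z B _ _ IH; apply: E_BangR IH => A; rewrite /flat_meta !flatsE.
  exact: map_Bang_bangs.
- move=> X z1 z2 G1 G2 G3 B _ _ _.
  apply: (@flat_mstep b X G1 G3 _ _ [:: TB z2 G2] G2) => L R.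
  rewrite !flatsE -!catA.
  have := @E_bangs_contract b (L ++ flat_stoup z1) (map erase z2) (flats G1) (flats G2 ++ R).
  by rewrite -!catA; apply.
- move=> z B _ _ _ IH; apply: E_BangR IH => A; rewrite /flat_meta !flatsE.
  exact: map_Bang_bangs.
- move=> X z1 z2 z' G1 G2 G3 B _ _ _.
  apply: (@flat_mstep b X G1 G3 _ _ [:: TB (z' ++ z2) G2] G2) => L R.
  rewrite !flatsE -!catA => IH.
  (* The part [z'] is permuted out of the bracket, while [z2] is contracted. *)
  have := @E_bangs_left b (L ++ flat_stoup z1 ++ flat_stoup z2) (map erase z')
    (flats G1) (flats G2 ++ R) (erase B).
  rewrite -!catA; apply.
  have := @E_bangs_contract b (L ++ flat_stoup z1) (map erase z2)
    (flats G1 ++ flat_stoup z') (flats G2 ++ R).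
  by rewrite -!catA; apply.
Qed.

(** * Undecidability *)

Lemma map_erase_id s : (forall A, List.In A s -> nobr A) -> map erase s = s.
Proof.
elim: s => //= A s IH h; rewrite erase_id; last by apply: h; left.
by rewrite IH // => B hB; apply: h; right.
Qed.

(** Erasure turns the bracketed program into the bracket-free one, so the soundness proof for E
    serves all five calculi. *)
Lemma erase_antecedent M n : map erase (antecedent Box M n) = antecedent id M n.
Proof.
have hr : map erase (map Box (rules M)) = rules M.
  rewrite -map_comp -[RHS]map_erase_id // => A hA; apply: nobr_frag.
  by apply: (@frag_nobr_program M); rewrite /program map_id; right.
have hc s : erase (collect s) = collect (map erase s) by elim: s => //= A s ->.
have hb s : map erase (map Bang s) = map Bang (map erase s).
  by elim: s => //= A s ->.
by rewrite /antecedent map_cat map_nseq hb /program map_id map_cons hc hr.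
Qed.

Lemma flat_map_FF s : flat (map FF s) = map erase s.
Proof. by elim: s => //= A s <-. Qed.

Lemma flats_map_TF s : flats (map TF s) = map erase s.
Proof. by elim: s => //= A s <-. Qed.

Lemma E_simulation b M n :
  Eder b (antecedent id M n) (st 0) <-> halts M (init n).
Proof. by split; [exact: E_simulation_sound | exact: E_simulation_complete]. Qed.

Lemma F_simulation M n :
  Fder (map FF (antecedent Box M n)) (st 0) <-> halts M (init n).
Proof.
split=> [/(F_erase true)|]; last exact: F_simulation_complete.
by rewrite flat_map_FF erase_antecedent; exact: E_simulation_sound.
Qed.

Lemma M_simulation b M n :
  Mder b ([::], map TF (antecedent Box M n)) (st 0) <-> halts M (init n).
Proof.
split=> [/(M_erase true)|]; last exact: M_simulation_complete.
by rewrite /flat_meta flats_map_TF erase_antecedent; exact: E_simulation_sound.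
Qed.

Lemma in_antecedent wr M n A : List.In A (antecedent wr M n) ->
  A = ltr 0 \/ exists B, A = Bang B /\ List.In B (program wr M).
Proof.
move=> /in_catP[|/in_mapP[B [<- hB]]]; last by right; exists B.
by elim: n => //= n IH [<-|/IH]; auto.
Qed.

Lemma E_frag_antecedent M n : E_frag (antecedent id M n) (st 0).
Proof.
split=> // A /in_antecedent[-> //|[B [-> /frag_nobr_program]]].
by [].
Qed.

Lemma frag_antecedent M n A : List.In A (antecedent Box M n) -> frag1 A.
Proof.
have hf B : frag1_nobr B -> frag1 (Box B).
  by elim: B => //= [C IHC D IHD [/IHC ? /IHD ?]].
by move=> /in_antecedent[-> //|[B [-> /(frag_program hf)]]].
Qed.

Lemma F_frag_antecedent M n : F_frag (map FF (antecedent Box M n)) (st 0).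
Proof. by split=> // t /in_mapP[A [<- /frag_antecedent]]. Qed.

Lemma M_frag_antecedent M n : M_frag ([::], map TF (antecedent Box M n)) (st 0).
Proof. by split=> //; split=> // t /in_mapP[A [<- /frag_antecedent]]. Qed.

Lemma ftokens_antecedent T (enc : T -> GenTree.tree nat) (f : fm -> T) wr M n :
  ftokens (map enc (map f (antecedent wr M n))) =
  flatten (nseq n (tokens (enc (f (ltr 0))))) ++
  ftokens (map enc (map f (map Bang (program wr M)))).
Proof. by rewrite /ftokens !map_cat flatten_cat !map_nseq. Qed.

Lemma E_undecidable b :
  ~ cm_decidable code_E (fun s => E_frag s.1 s.2) (fun s => Eder b s.1 s.2).
Proof.
pose mk M n := (antecedent id M n, st 0).
have [|A [B [A' [B' h]]]] := @code_affine _ code_E [:: opening 0; opening 0]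
    (tokens (enc_fm (ltr 0))) mk
    (fun M => ftokens (map enc_fm (map id (map Bang (program id M)))) ++
       [:: closing] ++ tokens (enc_fm (st 0)) ++ [:: closing]).
  move=> M n; rewrite /code_E pickle_tokens tokens_node 2!ftokens_cons tokens_node.
  by rewrite -(map_id (mk M n).1) ftokens_antecedent -!catA.
apply: (diagonal h) => M n; [exact: E_frag_antecedent | exact: E_simulation].
Qed.

Lemma F_undecidable :
  ~ cm_decidable code_F (fun s => F_frag s.1 s.2) (fun s => Fder s.1 s.2).
Proof.
pose mk M n := (map FF (antecedent Box M n), st 0).
have [|A [B [A' [B' h]]]] := @code_affine _ code_F [:: opening 0; opening 0]
    (tokens (enc_ftm (FF (ltr 0)))) mk
    (fun M => ftokens (map enc_ftm (map FF (map Bang (program Box M)))) ++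
       [:: closing] ++ tokens (enc_fm (st 0)) ++ [:: closing]).
  move=> M n; rewrite /code_F pickle_tokens tokens_node 2!ftokens_cons tokens_node.
  by rewrite ftokens_antecedent -!catA.
apply: (diagonal h) => M n; [exact: F_frag_antecedent | exact: F_simulation].
Qed.

Lemma M_undecidable b :
  ~ cm_decidable code_M (fun s => M_frag s.1 s.2) (fun s => Mder b s.1 s.2).
Proof.
pose mk M n := (([::] : seq fm, map TF (antecedent Box M n)), st 0).
(* The empty stoup accounts for the additional pair of opening and closing tokens. *)
have [|A [B [A' [B' h]]]] := @code_affine _ code_M
    [:: opening 0; opening 0; closing; opening 0] (tokens (enc_tm (TF (ltr 0)))) mk
    (fun M => ftokens (map enc_tm (map TF (map Bang (program Box M)))) ++
       [:: closing] ++ tokens (enc_fm (st 0)) ++ [:: closing]).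
  move=> M n; rewrite /code_M pickle_tokens tokens_node 3!ftokens_cons 2!tokens_node.
  by rewrite ftokens_antecedent -!catA.
apply: (diagonal h) => M n; [exact: M_frag_antecedent | exact: M_simulation].
Qed.

Theorem theorem13 :
  ~ cm_decidable code_E (fun s => E_frag s.1 s.2) (fun s => E_derivable s.1 s.2) /\
  ~ cm_decidable code_E (fun s => E_frag s.1 s.2) (fun s => Er_derivable s.1 s.2) /\
  ~ cm_decidable code_F (fun s => F_frag s.1 s.2) (fun s => F_derivable s.1 s.2) /\
  ~ cm_decidable code_M (fun s => M_frag s.1 s.2) (fun s => M'_derivable s.1 s.2) /\
  ~ cm_decidable code_M (fun s => M_frag s.1 s.2) (fun s => M_derivable s.1 s.2).
Proof.
exact: (conj (@E_undecidable true) (conj (@E_undecidable false)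
  (conj F_undecidable (conj (@M_undecidable true) (@M_undecidable false))))).
Qed.
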